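(* Consider the forward process $q(\mathbf{x}_{0:N})$ and the Gaussian Markov reverse model $p(\mathbf{x}_{0:N})$ described in the context, and the problem $$\min_{\{\boldsymbol{\mu}_n,\sigma_n^2\}_{n=1}^N} D_{\mathrm{KL}}\big(q(\mathbf{x}_{0:N})\,\|\,p(\mathbf{x}_{0:N})\big).$$ An optimal solution is given, for every $n\in\{1,\dots,N\}$, by $$\boldsymbol{\mu}_n^*(\mathbf{x}_n)=\tilde{\boldsymbol{\mu}}_n\Big(\mathbf{x}_n,\tfrac{1}{\sqrt{\overline{\alpha}_n}}\big(\mathbf{x}_n+\overline{\beta}_n\nabla_{\mathbf{x}_n}\log q_n(\mathbf{x}_n)\big)\Big),$$ $$\sigma_n^{*2}=\lambda_n^2+\Big(\sqrt{\tfrac{\overline{\beta}_n}{\alpha_n}}-\sqrt{\overline{\beta}_{n-1}-\lambda_n^2}\Big)^2\Big(1-\overline{\beta}_n\,\mathbb{E}_{q_n(\mathbf{x}_n)}\frac{\|\nabla_{\mathbf{x}_n}\log q_n(\mathbf{x}_n)\|^2}{d}\Big),$$ where $q_n$ is the marginal density of $\mathbf{x}_n$ under the forward process.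
   Context: Let $d,N\ge 1$. Let $\beta_1,\dots,\beta_N\in(0,1)$, $\alpha_n:=1-\beta_n$, $\overline{\alpha}_n:=\prod_{i=1}^n\alpha_i$, $\overline{\beta}_n:=1-\overline{\alpha}_n$, with the conventions $\overline{\alpha}_0:=1$, $\overline{\beta}_0:=0$. Let $\lambda=(\lambda_1,\dots,\lambda_N)$ be nonnegative with $\lambda_n^2\le\overline{\beta}_{n-1}$ (so $\lambda_1=0$). Let $q(\mathbf{x}_0)$ be a probability density on $\mathbb{R}^d$ with finite second moments. Define $\tilde{\boldsymbol{\mu}}_n(\mathbf{x}_n,\mathbf{x}_0):=\sqrt{\overline{\alpha}_{n-1}}\,\mathbf{x}_0+\sqrt{\overline{\beta}_{n-1}-\lambda_n^2}\cdot\frac{\mathbf{x}_n-\sqrt{\overline{\alpha}_n}\mathbf{x}_0}{\sqrt{\overline{\beta}_n}}$. The forward process is $q(\mathbf{x}_{0:N})=q(\mathbf{x}_0)\,q(\mathbf{x}_N|\mathbf{x}_0)\prod_{n=2}^N q(\mathbf{x}_{n-1}|\mathbf{x}_n,\mathbf{x}_0)$ with $q(\mathbf{x}_N|\mathbf{x}_0)=\mathcal{N}(\mathbf{x}_N|\sqrt{\overline{\alpha}_N}\mathbf{x}_0,\overline{\beta}_N\mathbf{I})$ and $q(\mathbf{x}_{n-1}|\mathbf{x}_n,\mathbf{x}_0)=\mathcal{N}(\mathbf{x}_{n-1}|\tilde{\boldsymbol{\mu}}_n(\mathbf{x}_n,\mathbf{x}_0),\lambda_n^2\mathbf{I})$;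 under it $q(\mathbf{x}_n|\mathbf{x}_0)=\mathcal{N}(\sqrt{\overline{\alpha}_n}\mathbf{x}_0,\overline{\beta}_n\mathbf{I})$ for all $n$. The reverse model is $p(\mathbf{x}_{0:N})=p(\mathbf{x}_N)\prod_{n=1}^N p(\mathbf{x}_{n-1}|\mathbf{x}_n)$ with $p(\mathbf{x}_N)=\mathcal{N}(\mathbf{0},\mathbf{I})$ and $p(\mathbf{x}_{n-1}|\mathbf{x}_n)=\mathcal{N}(\mathbf{x}_{n-1}|\boldsymbol{\mu}_n(\mathbf{x}_n),\sigma_n^2\mathbf{I})$, where $\boldsymbol{\mu}_n:\mathbb{R}^d\to\mathbb{R}^d$ and $\sigma_n^2>0$ are free. *)

(* Defs.v *)
From HB Require Import structures.
From mathcomp Require Import all_boot all_order all_algebra.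
From mathcomp Require Import all_classical all_reals all_analysis.
Set Implicit Arguments.
Unset Strict Implicit.
Unset Printing Implicit Defensive.
Import Order.TTheory GRing.Theory Num.Theory.
Import numFieldNormedType.Exports.
Local Open Scope classical_set_scope.
Local Open Scope ring_scope.

Section DiffusionDefs.
Context {R : realType}.

(* tprod mu k A = (mu x ... x mu)(A), defined by iterated integration of the
   indicator of A (Tonelli); tprod lebesgue_measure k is Lebesgue measure
   on R^k (coordinates are k.-tuples). *)
Fixpoint tprod {dT} {T : measurableType dT} (mu : set T -> \bar R) (k : nat)
  : set (k.-tuple T) -> \bar R :=
  match k return set (k.-tuple T) -> \bar R with
  | 0 => fun A => ((\1_A [tuple] : R)%:E)
  | k'.+1 => fun A =>
      (\int[mu]_x @tprod dT T mu k' (fun t => A (cons_tuple x t)))%E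
  end.
Arguments tprod {dT T} mu k.

Definition lebRd (d : nat) : set (d.-tuple R) -> \bar R :=
  tprod (@lebesgue_measure R) d.
Arguments lebRd : clear implicits.

(* points of R^d are row vectors; tuples are used only as measurable carrier *)
Definition rv d (t : d.-tuple R) : 'rV[R]_d := \row_i tnth t i.
Definition tuple_of_rv d (v : 'rV[R]_d) : d.-tuple R := [tuple v 0 i | i < d].

Definition rmeas_vec d (f : 'rV[R]_d -> 'rV[R]_d) : Prop :=
  measurable_fun setT (fun t : d.-tuple R => tuple_of_rv (f (rv t))).
Definition rmeas_real d (f : 'rV[R]_d -> R) : Prop :=
  measurable_fun setT (fun t : d.-tuple R => f (rv t)).

Definition sqnorm d (v : 'rV[R]_d) : R := \sum_(i < d) v 0 i ^+ 2.

Definition gauss_pdf d (m : 'rV[R]_d) (s2 : R) (x : 'rV[R]_d) : R :=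
  ((Num.sqrt (2 * pi * s2)) ^+ d)^-1 * expR (- sqnorm (x - m) / (2 * s2)).

(* integration of a nonnegative g against N(m, s2 I); for s2 = 0 this is the
   degenerate Gaussian (Dirac mass at m) *)
Definition gauss_int d (m : 'rV[R]_d) (s2 : R) (g : 'rV[R]_d -> \bar R)
  : \bar R :=
  if s2 == 0 then g m
  else (\int[lebRd d]_t ((gauss_pdf m s2 (rv t))%:E * g (rv t)))%E.

Definition abar (beta : nat -> R) (n : nat) : R :=
  \prod_(1 <= i < n.+1) (1 - beta i).
Definition bbar (beta : nat -> R) (n : nat) : R := 1 - abar beta n.

Definition mu_tilde d (beta lam : nat -> R) (n : nat) (xn x0 : 'rV[R]_d)
  : 'rV[R]_d :=
  Num.sqrt (abar beta n.-1) *: x0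
  + (Num.sqrt (bbar beta n.-1 - lam n ^+ 2) / Num.sqrt (bbar beta n))
      *: (xn - Num.sqrt (abar beta n) *: x0).

Definition joint_of d N (acc : nat -> 'rV[R]_d) : (N.+1).-tuple (d.-tuple R) :=
  [tuple tuple_of_rv (acc i) | i < N.+1].

Definition upd d (acc : nat -> 'rV[R]_d) (i : nat) (y : 'rV[R]_d) :=
  fun j => if j == i then y else acc j.

(* forward chain: given x_0 and x_n,...,x_N in acc, draw
   x_{n-1} ~ q(x_{n-1} | x_n, x_0) for n, n-1, ..., 2 *)
Fixpoint fwd_chain d (beta lam : nat -> R) (n : nat) (acc : nat -> 'rV[R]_d)
  (g : (nat -> 'rV[R]_d) -> \bar R) : \bar R :=
  match n with
  | O => g acc
  | S O => g acc
  | S m => gauss_int (mu_tilde beta lam n (acc n) (acc 0)) (lam n ^+ 2)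
             (fun y => fwd_chain beta lam m (upd acc m y) g)
  end.

Definition fwd_measure d N (beta lam : nat -> R) (q0 : 'rV[R]_d -> R)
  (A : set ((N.+1).-tuple (d.-tuple R))) : \bar R :=
  (\int[lebRd d]_t ((q0 (rv t))%:E *
     gauss_int (Num.sqrt (abar beta N) *: rv t) (bbar beta N)
       (fun xN => fwd_chain beta lam N (upd (upd (fun=> (0 : 'rV[R]_d)%R) 0 (rv t)) N xN)
          (fun acc => (\1_A (joint_of N acc) : R)%:E))))%E.

(* reverse chain: given x_n,...,x_N, draw x_{n-1} ~ N(mu_n(x_n), s2_n I) *)
Fixpoint rev_chain d (mu : nat -> 'rV[R]_d -> 'rV[R]_d) (s2 : nat -> R)
  (n : nat) (acc : nat -> 'rV[R]_d) (g : (nat -> 'rV[R]_d) -> \bar R)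
  : \bar R :=
  match n with
  | O => g acc
  | S m => gauss_int (mu n (acc n)) (s2 n)
             (fun y => rev_chain mu s2 m (upd acc m y) g)
  end.

Definition rev_measure d N (mu : nat -> 'rV[R]_d -> 'rV[R]_d) (s2 : nat -> R)
  (A : set ((N.+1).-tuple (d.-tuple R))) : \bar R :=
  gauss_int 0 1 (fun xN => rev_chain mu s2 N (upd (fun=> (0 : 'rV[R]_d)%R) N xN)
                   (fun acc => (\1_A (joint_of N acc) : R)%:E)).

(* KL divergence of probability measures: int_P f ln f with f = dQ/dP a
   density of Q w.r.t. P (all such densities agree P-a.e.); +oo when
   Q is not absolutely continuous w.r.t. P (no density: inf of empty set). *)
Definition KL {dT} {T : measurableType dT} (Q P : set T -> \bar R) : \bar R :=
  ereal_inf [set (\int[P]_x ((f x * ln (f x))%:E))%E | f in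
    [set f : T -> R | [/\ measurable_fun setT f, (forall x, 0 <= f x) &
       forall A, measurable A -> Q A = (\int[P]_(x in A) (f x)%:E)%E]]].

Definition marg d (beta : nat -> R) (q0 : 'rV[R]_d -> R) (n : nat)
  (x : 'rV[R]_d) : R :=
  fine (\int[lebRd d]_t ((q0 (rv t) *
          gauss_pdf (Num.sqrt (abar beta n) *: rv t) (bbar beta n) x)%:E))%E.

Definition score d (beta : nat -> R) (q0 : 'rV[R]_d -> R) (n : nat)
  (x : 'rV[R]_d) : 'rV[R]_d :=
  \row_i ('D_(delta_mx 0 i) (fun y => ln (marg beta q0 n y)) x).

Definition mu_star d (beta lam : nat -> R) (q0 : 'rV[R]_d -> R) (n : nat)
  (x : 'rV[R]_d) : 'rV[R]_d :=
  mu_tilde beta lam n x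
    ((Num.sqrt (abar beta n))^-1 *: (x + bbar beta n *: score beta q0 n x)).

Definition fisher d (beta : nat -> R) (q0 : 'rV[R]_d -> R) (n : nat) : R :=
  fine (\int[lebRd d]_t
          ((marg beta q0 n (rv t) * sqnorm (score beta q0 n (rv t)))%:E))%E.

Definition sigma2_star d (beta lam : nat -> R) (q0 : 'rV[R]_d -> R) (n : nat)
  : R :=
  lam n ^+ 2
  + (Num.sqrt (bbar beta n / (1 - beta n)) - Num.sqrt (bbar beta n.-1 - lam n ^+ 2)) ^+ 2
    * (1 - bbar beta n * fisher beta q0 n / d%:R).

Definition is_density_2mom d (q0 : 'rV[R]_d -> R) : Prop :=
  [/\ rmeas_real q0, (forall x, 0 <= q0 x),
      (\int[lebRd d]_t (q0 (rv t))%:E)%E = 1%E &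
      ((\int[lebRd d]_t ((q0 (rv t) * sqnorm (rv t))%:E))%E < +oo)%E].

End DiffusionDefs.
Arguments fwd_measure {R d} N beta lam q0 A.
Arguments rev_measure {R d} N mu s2 A.

(* Main.v *)
(* The laws P of the optimal chain and P' of any other chain have an explicit density
   ratio r, a product of ratios of Gaussian densities, so a density f of the forward law Q
   with respect to P' turns into the density r f with respect to P, and the difference
   of the two divergences is E_Q[ln r] (when KL(Q || P') = +oo there is nothing to prove).
   Up to constants, ln r is a sum over n of weighted squares |x_(n-1) - mu_n(x_n)|^2.
   The marginals of Q are Gaussian given x_0, hence each expected square only involves
   (x_(n-1), x_n, x_0). By Tweedie's formula x_n + bbar_n * score(x_n) is sqrt(abar_n) times
   the posterior mean of x_0, so mu_n^* is the conditional mean of x_(n-1) given x_n, and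
   Pythagoras gives E|x_(n-1) - mu_n(x_n)|^2 >= d sigma_n^*^2 with equality at mu_n^*.
   The remaining optimisation over the variances is the inequality ln x <= x - 1. *)
Require Import Defs.
From HB Require Import structures.
From mathcomp Require Import all_boot all_order all_algebra.
From mathcomp Require Import all_classical all_reals all_analysis.
From mathcomp Require Import measurable_realfun lebesgue_integral_fubini ring lra.
Set Implicit Arguments.
Unset Strict Implicit.
Unset Printing Implicit Defensive.
Import Order.TTheory GRing.Theory Num.Theory.
Import numFieldNormedType.Exports.
Local Open Scope classical_set_scope.
Local Open Scope ring_scope.

(** The variances [lam n ^+ 2] may vanish, so the forward law mixes Gaussian and Dirac transitions
    and need not have a Lebesgue density: the divergence cannot be expanded as an integral of q ln
    (q / p). Only the two reverse laws are compared through densities, because their transitions are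
    non-degenerate and their ratio is positive and finite everywhere. When lambda_n = 0 for some n
    >= 2, the forward law sits on a null graph and both divergences are infinite; the comparison
    covers this case without distinguishing it. Both laws are given as iterated integrals of
    indicators, hence as bare set functions. They are treated as monotone functionals on nonnegative
    functions. The reverse ones are then turned into measures, as the integrals in [KL] require,
    while the forward one remains a functional. The expected squares of a competitor may be
    infinite, so they are kept in [\bar R] and only bounded below. Admissibility of the optimum
    includes strict positivity of its variances. It holds because [q0] is a density: the posterior
    of x_0 cannot be a point mass. *)

Section GeT.
Context {R : realType} {dT : measure_display} {T : measurableType dT}.
Variable mu : {measure set T -> \bar R}.
Local Open Scope ereal_scope.

Lemma ge0_integralTZl (c : R) (f : T -> \bar R) : (0 <= c)%R ->
  measurable_fun setT f -> (forall x, 0 <= f x) ->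
  \int[mu]_x (c%:E * f x) = c%:E * \int[mu]_x f x.
Proof. by move=> c0 mf f0; apply: ge0_integralZl_EFin. Qed.

Lemma ge0_integralTD (f g : T -> \bar R) :
  measurable_fun setT f -> (forall x, 0 <= f x) ->
  measurable_fun setT g -> (forall x, 0 <= g x) ->
  \int[mu]_x (f x + g x) = \int[mu]_x f x + \int[mu]_x g x.
Proof.
by move=> mf f0 mg g0; apply: ge0_integralD.
Qed.

Lemma ge0_le_integralT (f g : T -> \bar R) :
  measurable_fun setT f -> (forall x, 0 <= f x) ->
  measurable_fun setT g -> (forall x, f x <= g x) ->
  \int[mu]_x f x <= \int[mu]_x g x.
Proof.
by move=> mf f0 mg fg; apply: ge0_le_integral.
Qed.

End GeT.

(** * Lebesgue measure on R^d *)

Section Tprod.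
Context {R : realType} {dT : measure_display} {T : measurableType dT}.
Variable mu : {sigma_finite_measure set T -> \bar R}.

Definition consT k (p : T * k.-tuple T) : k.+1.-tuple T := cons_tuple p.1 p.2.
Definition unconsT k (t : k.+1.-tuple T) : T * k.-tuple T := (thead t, behead_tuple t).

Lemma consTK k : cancel (@consT k) (@unconsT k).
Proof. by case=> x t; rewrite /consT /unconsT /=; congr (_, _); apply/val_inj. Qed.

Lemma measurable_consT k : measurable_fun setT (@consT k).
Proof. exact: measurable_cons. Qed.

Lemma measurable_unconsT k : measurable_fun setT (@unconsT k).
Proof.
apply/measurable_fun_pairP; split.
  exact: measurable_tnth.
exact: measurable_behead.
Qed.

(** The iterated integral is the pushforward of a product measure along [consT]. Sigma-finiteness is
    carried through the induction because the next product needs it. *)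
Lemma tprod_measure k :
  exists m : {sigma_finite_measure set (k.-tuple T) -> \bar R},
    (m : set _ -> \bar R) = tprod mu (k := k).
Proof.
elim: k => [|k [m mE]].
  by exists (dirac [tuple]).
pose nu0 : {measure set _ -> \bar R} := pushforward (mu \x m)%E (@consT k).
pose nu := nu0 (measurable_consT (k := k)).
have nuE : (nu : set _ -> \bar R) = tprod mu (k := k.+1).
  apply/funext => A; rewrite /nu /= /pushforward /product_measure1 -mE.
  by apply: eq_integral => x _ /=; congr (m _); apply/seteqP; split => t;
    rewrite /xsection /= inE.
have sf : sigma_finite setT nu.
  have /sigma_finiteP[F [FT ndF Foo]] := sigma_finiteT mu.
  have /sigma_finiteP[G [GT ndG Goo]] := sigma_finiteT m.
  have ncoK : @unconsT k \o @consT k = id by apply/funext => p /=; rewrite consTK.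
  (* The two covers are taken increasing: the components of a point may lie in [F i] and [G j] with
     different indices, and then the point lies in the rectangle of index [maxn i j]. *)
  exists (fun n => @unconsT k @^-1` (F n `*` G n)).
    apply/seteqP; split=> // t _.
    have [i _ Fi] : (\bigcup_i F i) (unconsT t).1 by rewrite -FT.
    have [j _ Gj] : (\bigcup_i G i) (unconsT t).2 by rewrite -GT.
    exists (maxn i j) => //; split.
      by move: Fi; exact/subsetPset/ndF/leq_maxl.
    by move: Gj; exact/subsetPset/ndG/leq_maxr.
  move=> n; have [mF Fn] := Foo n; have [mG Gn] := Goo n; split.
    rewrite -[X in measurable X]setTI; apply: measurable_unconsT => //.
    exact: measurableX.
  rewrite /nu /= /pushforward -comp_preimage ncoK preimage_id.
  by rewrite product_measure1E// lte_mul_pinfty// ge0_fin_numE.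
pose nu' : {sigma_finite_measure set _ -> \bar R} :=
  HB.pack (nu : set _ -> \bar R) (Measure_isSigmaFinite.Build _ _ _ nu sf) nu.
by exists nu'; rewrite -nuE.
Qed.

End Tprod.

Section LebRd.
Context {R : realType}.

Lemma lebRd_measure d :
  exists m : {sigma_finite_measure set (d.-tuple (measurableTypeR R)) -> \bar R},
    (m : set _ -> \bar R) = @lebRd R d.
Proof. exact: (@tprod_measure R _ _ (@lebesgue_measure R)). Qed.

Section mixins.
Variable d : nat.

(** The measure structure is put on [lebRd] itself, by transport from [lebRd_measure], so that
    integration lemmas apply directly to the integrals in the definitions. *)
Let lebRd0 : @lebRd R d set0 = 0%E.
Proof. by have [m <-] := lebRd_measure d; exact: measure0. Qed.

Let lebRd_ge0 A : (0 <= @lebRd R d A)%E.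
Proof. by have [m <-] := lebRd_measure d; exact: measure_ge0. Qed.

Let lebRd_additive : semi_sigma_additive (@lebRd R d).
Proof.
have [m mE] := lebRd_measure d => F mF tF mUF; rewrite -mE.
exact: (@measure_semi_sigma_additive _ _ _ m F mF tF mUF). Qed.

HB.instance Definition _ := isMeasure.Build _ _ _ (@lebRd R d)
  lebRd0 lebRd_ge0 lebRd_additive.

Let lebRd_sfinite : sigma_finite setT (@lebRd R d).
Proof.
have [m mE] := lebRd_measure d; have [F FT Fm] := sigma_finiteT m.
exists F => // i; have [mF Foo] := Fm i; split => //.
by have /= <- := congr1 (fun f => f (F i)) mE. Qed.

HB.instance Definition _ := Measure_isSigmaFinite.Build _ _ _ (@lebRd R d)
  lebRd_sfinite.

End mixins.

Lemma integral_lebRdS k (F : k.+1.-tuple R -> \bar R) :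
  measurable_fun setT F -> (forall t, 0 <= F t)%E ->
  (\int[@lebRd R k.+1]_t F t =
   \int[@lebesgue_measure R]_x \int[@lebRd R k]_t F (cons_tuple x t))%E.
Proof.
move=> mF F0.
have mc : measurable_fun setT
    (fun p : measurableTypeR R * k.-tuple R => cons_tuple p.1 p.2 : k.+1.-tuple R).
  exact: (measurable_cons (T2 := R) (T1 := (measurableTypeR R * k.-tuple R)%type)).
transitivity (\int[pushforward (@lebesgue_measure R \x @lebRd R k)%E
  (fun p : measurableTypeR R * k.-tuple R => cons_tuple p.1 p.2 : k.+1.-tuple R)]_t F t)%E.
  apply: eq_measure_integral => A mA _ /=; rewrite /pushforward /product_measure1.
  apply: eq_integral => x _ /=; congr (lebRd _); apply/seteqP; split => t;
    by rewrite /xsection /= inE.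
rewrite ge0_integral_pushforward//.
rewrite preimage_setT fubini_tonelli1//; first exact: measurableT_comp.
by move=> p; exact: F0.
Qed.

Lemma integral_lebRd0 (F : 0.-tuple R -> \bar R) :
  measurable_fun setT F -> (\int[@lebRd R 0]_t F t = F [tuple])%E.
Proof.
move=> mF; transitivity (\int[\d_([tuple] : 0.-tuple R)]_t F t)%E.
  by congr integral.
by rewrite integral_dirac// diracT mul1e.
Qed.

(** By uniqueness of Lebesgue measure: the image of Lebesgue measure under the affine map,
    multiplied by [c], has the right value on half-open intervals. *)
Lemma lebesgue_measure_affine (c m : R) (A : set R) : 0 < c -> measurable A ->
  lebesgue_measure ((fun x => c * x + m) @^-1` A) =
  ((c^-1)%:E * lebesgue_measure A)%E.
Proof.
move=> c0 mA.
pose f : R -> measurableTypeR R := fun x => c * x + m.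
have mf : measurable_fun setT f by apply: measurable_funD => //; exact: measurable_funM.
pose nu0 : {measure set _ -> \bar R} := pushforward (@lebesgue_measure R) f.
pose nu := mscale (NngNum (ltW c0)) (nu0 mf).
have -> : lebesgue_measure A = nu A.
  apply: lebesgue_measure_unique => //= _ [[a b]] _ <-.
  rewrite /nu /mscale /= /pushforward.
  rewrite (_ : f @^-1` _ = `](a - m) / c, (b - m) / c]%classic); last first.
    apply/seteqP; split => x /=; rewrite /f !in_itv/= ltr_pdivrMr// ler_pdivlMr//;
      by rewrite ltrBlDr lerBrDr (mulrC c).
  rewrite !lebesgue_measure_itv/= !lte_fin ltr_pM2r ?invr_gt0// ltrD2r.
  case: ifP => _; last by rewrite mule0.
  by rewrite -!EFinB -EFinM -mulrBl mulrC divfK ?gt_eqF//; congr (_%:E); ring.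
by rewrite /nu /mscale /= /pushforward muleA -EFinM mulVf ?gt_eqF// mul1e.
Qed.

Lemma ge0_integral_affine1 (c m : R) (f : R -> \bar R) : 0 < c ->
  measurable_fun setT f -> (forall x, 0 <= f x)%E ->
  (\int[lebesgue_measure]_x f (c * x + m)%R =
   (c^-1)%:E * \int[lebesgue_measure]_x f x)%E.
Proof.
move=> c0 mf f0.
have c0' : 0 <= c^-1 by rewrite invr_ge0 ltW.
have mg : measurable_fun setT (fun x : measurableTypeR R => (c * x + m : measurableTypeR R)).
  by apply: measurable_funD => //; exact: measurable_funM.
rewrite -[in RHS](ge0_integral_mscale _ measurableT (NngNum c0'))//.
transitivity (\int[pushforward (@lebesgue_measure R)
    (fun x : measurableTypeR R => (c * x + m)%R : measurableTypeR R)]_x f x)%E.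
  by rewrite ge0_integral_pushforward.
apply: eq_measure_integral => A mA _.
rewrite /= /pushforward; move: (@lebesgue_measure_affine c m A c0 mA) => /= ->.
by rewrite /mscale.
Qed.

Lemma ge0_integral_reflect1 (m : R) (f : R -> \bar R) :
  measurable_fun setT f -> (forall x, 0 <= f x)%E ->
  (\int[lebesgue_measure]_x f (m - x)%R = \int[lebesgue_measure]_x f x)%E.
Proof.
move=> mf f0.
transitivity (\int[lebesgue_measure]_x f (1 * x + m)%R)%E; last first.
  by rewrite ge0_integral_affine1// invr1 mul1e.
have mg : measurable_fun setT (-%R : measurableTypeR R -> measurableTypeR R) by [].
have mh : measurable_fun setT (fun x : R => f (m - x)%R).
  by apply: measurableT_comp => //; exact: measurable_funB.
transitivity (\int[pushforward (@lebesgue_measure R)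
    (-%R : measurableTypeR R -> measurableTypeR R)]_x f (m - x)%R)%E.
  by apply: eq_measure_integral => A mA _; exact/esym/lebesgue_measureN.
rewrite ge0_integral_pushforward//.
by apply: eq_integral => x _ /=; rewrite opprK mul1r addrC.
Qed.

End LebRd.

Section Affine.
Context {R : realType}.

Lemma measurable_rvP dS (S : measurableType dS) k (f : S -> 'rV[R]_k) :
  measurable_fun setT (fun s => tuple_of_rv (f s)) <->
  forall i, measurable_fun setT (fun s => f s 0 i).
Proof.
split => [/measurable_fun_tnthP + i|H].
  by move=> /(_ i); rewrite (_ : _ \o _ = fun s => f s 0 i)//; apply/funext => s /=;
    rewrite tnth_mktuple.
apply/measurable_fun_tnthP => i; rewrite (_ : _ \o _ = fun s => f s 0 i)//.
by apply/funext => s /=; rewrite tnth_mktuple.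
Qed.

Lemma rvK k : cancel (@rv R k) (@tuple_of_rv R k).
Proof. by move=> t; apply/eq_from_tnth => i; rewrite tnth_mktuple mxE. Qed.

Lemma tuple_of_rvK k : cancel (@tuple_of_rv R k) (@rv R k).
Proof. by move=> v; apply/rowP => i; rewrite mxE tnth_mktuple. Qed.

Definition affine_tuple k (c : R) (m : k.-tuple R) (t : k.-tuple R) : k.-tuple R :=
  tuple_of_rv (c *: rv t + rv m).

Lemma measurable_affine_tuple k (c : R) (m : k.-tuple R) :
  measurable_fun setT (affine_tuple c m).
Proof.
apply/measurable_rvP => i; under eq_fun do rewrite !mxE.
apply: measurable_funD => //; apply: measurable_funM => //; exact: measurable_tnth.
Qed.

(** The map acts coordinatewise, so each of the [k] coordinates contributes a factor [c^-1]. The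
    shift [m] is generalised because the induction passes to its tail. *)
Lemma integral_lebRd_affine k (c : R) (m : k.-tuple R) (F : k.-tuple R -> \bar R) :
  0 < c -> measurable_fun setT F -> (forall t, 0 <= F t)%E ->
  (\int[@lebRd R k]_t F (affine_tuple c m t) =
   ((c ^+ k)^-1)%:E * \int[@lebRd R k]_t F t)%E.
Proof.
move=> c0; elim: k => [|k IH] in m F * => mF F0.
  rewrite !integral_lebRd0//; last first.
    by apply: measurableT_comp => //; exact: measurable_affine_tuple.
  by rewrite expr0 invr1 mul1e; congr F; apply/eq_from_tnth => -[].
have mcons x : measurable_fun setT (fun t : k.-tuple R => cons_tuple x t : k.+1.-tuple R).
  exact: (measurable_cons (T2 := R) (T1 := k.-tuple R)).
rewrite !integral_lebRdS//; last first.
  by apply: measurableT_comp => //; exact: measurable_affine_tuple.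
pose G (x : R) := (\int[@lebRd R k]_t F (cons_tuple x t))%E.
have mG : measurable_fun setT G.
  have mc : measurable_fun setT
      (fun p : R * k.-tuple R => cons_tuple p.1 p.2 : k.+1.-tuple R).
    exact: (measurable_cons (T2 := R) (T1 := (R * k.-tuple R)%type)).
  apply: (measurable_fun_fubini_tonelli_F (m2 := @lebRd R k)
    (fun p : R * k.-tuple R => F (cons_tuple p.1 p.2))) => //.
  exact: measurableT_comp.
have G0 x : (0 <= G x)%E by apply: integral_ge0.
transitivity (\int[lebesgue_measure]_x
    (((c ^+ k)^-1)%:E * G (c * x + thead m)%R))%E.
  apply: eq_integral => x _; rewrite -(IH (behead_tuple m))//; last first.
    exact: measurableT_comp.
  apply: eq_integral => t _; congr F; apply/eq_from_tnth => i.
  rewrite tnth_mktuple !mxE; case: (unliftP ord0 i) => [j ->|->].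
    rewrite !tnthS tnth_mktuple !mxE; congr (_ + _).
    by rewrite [m in LHS]tuple_eta tnthS.
  by rewrite !tnth0.
rewrite ge0_integralZl//.
- rewrite ge0_integral_affine1// muleA -EFinM; congr (_%:E * _)%E.
  by rewrite exprS invfM mulrC.
- apply: (measurableT_comp mG); apply: measurable_funD => //; exact: measurable_funM.
- by rewrite lee_fin invr_ge0 exprn_ge0 // ltW.
Qed.

(** The slices of a point are empty except over its first coordinate, which is Lebesgue null. This
    later excludes a posterior concentrated at one point. *)
Lemma lebRd_set1 k (t : k.+1.-tuple R) : @lebRd R k.+1 [set t] = 0%E.
Proof.
rewrite /lebRd /= (_ : (fun x => _) = patch (cst 0%E)
    [set thead t] (fun x => @lebRd R k (fun u => [set t] (cons_tuple x u)))).
  by rewrite -integral_mkcond integral_set1.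
apply/funext => x; rewrite /patch; case: ifPn => //; rewrite notin_setE /= => xt.
rewrite -[RHS](measure0 (@lebRd R k)); congr (lebRd _).
by apply/seteqP; split => // u /= tE; apply: xt; rewrite -tE theadE.
Qed.

End Affine.

(** * Gaussian densities *)

Section Vmeas.
Context {R : realType}.

(** Testing coordinates avoids a sigma-algebra on row vectors; [measurable_rvP] identifies this
    notion with measurability of the associated tuple. *)
Definition vmeas dS (S : measurableType dS) k (f : S -> 'rV[R]_k) :=
  forall i, measurable_fun setT (fun s => f s 0 i).

Section ops.
Context dS (S : measurableType dS) (k : nat).
Implicit Types f g : S -> 'rV[R]_k.

Lemma vmeas_cst (v : 'rV[R]_k) : vmeas (fun _ : S => v).
Proof. by move=> i; exact: measurable_cst. Qed.

Lemma vmeasD f g : vmeas f -> vmeas g -> vmeas (fun s => f s + g s).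
Proof. by move=> mf mg i; under eq_fun do rewrite mxE; exact: measurable_funD. Qed.

Lemma vmeasB f g : vmeas f -> vmeas g -> vmeas (fun s => f s - g s).
Proof. by move=> mf mg i; under eq_fun do rewrite !mxE; exact: measurable_funB. Qed.

Lemma vmeasZ (c : R) f : vmeas f -> vmeas (fun s => c *: f s).
Proof. by move=> mf i; under eq_fun do rewrite !mxE; exact: measurable_funM. Qed.

Lemma vmeas_comp dU (U : measurableType dU) (h : U -> S) f :
  measurable_fun setT h -> vmeas f -> vmeas (fun u => f (h u)).
Proof. by move=> mh mf i; exact: (measurableT_comp (mf i)). Qed.

Lemma vmeas_tuple f : vmeas f -> measurable_fun setT (fun s => tuple_of_rv (f s)).
Proof. by move=> mf; apply/measurable_rvP. Qed.

Lemma measurable_sqnorm f : vmeas f -> measurable_fun setT (fun s => sqnorm (f s)).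
Proof.
by move=> mf; apply: measurable_sum => i; apply: measurable_funX; exact: mf.
Qed.

Lemma measurable_gauss_pdf f g (b : R) : vmeas f -> vmeas g ->
  measurable_fun setT (fun s => gauss_pdf (f s) b (g s)).
Proof.
move=> mf mg; apply: measurable_funM => //.
apply: measurableT_comp => //; apply: measurable_funM => //.
by apply: measurableT_comp => //; apply: measurable_sqnorm; exact: vmeasB.
Qed.

End ops.

Lemma vmeas_rv k : vmeas (@rv R k).
Proof. by move=> i; under eq_fun do rewrite mxE; exact: measurable_tnth. Qed.

Lemma vmeas_rv_comp dS (S : measurableType dS) k (h : S -> k.-tuple R) :
  measurable_fun setT h -> vmeas (fun s => rv (h s)).
Proof. by move=> mh; apply: vmeas_comp => //; exact: vmeas_rv. Qed.

Lemma sqnorm_ge0 k (v : 'rV[R]_k) : 0 <= sqnorm v.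
Proof. by apply: sumr_ge0 => i _; exact: sqr_ge0. Qed.

Lemma sqnormZ k (c : R) (v : 'rV[R]_k) : sqnorm (c *: v) = c ^+ 2 * sqnorm v.
Proof. by rewrite /sqnorm mulr_sumr; apply: eq_bigr => i _; rewrite mxE exprMn. Qed.

Lemma gauss_pdf_gt0 k (m : 'rV[R]_k) (b : R) x : 0 < b -> 0 < gauss_pdf m b x.
Proof.
move=> b0; rewrite mulr_gt0 ?expR_gt0// invr_gt0 exprn_gt0// sqrtr_gt0.
by rewrite !mulr_gt0// pi_gt0.
Qed.

Lemma gauss_pdf_ge0 k (m : 'rV[R]_k) (b : R) x : 0 <= gauss_pdf m b x.
Proof. by rewrite mulr_ge0 ?expR_ge0// invr_ge0 exprn_ge0// sqrtr_ge0. Qed.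

End Vmeas.

(** * Moments of the one-dimensional Gaussian *)

Section Gauss1.
Context {R : realType}.

(** The normal density parametrised by its variance [b], as in [gauss_pdf], whereas [normal_pdf]
    takes the standard deviation. *)
Definition phi (m b x : R) := (Num.sqrt (2 * pi * b))^-1 * expR (- (x - m) ^+ 2 / (2 * b)).

Lemma phi_ge0 m b x : 0 <= phi m b x.
Proof. by rewrite mulr_ge0 ?expR_ge0// invr_ge0 sqrtr_ge0. Qed.

Lemma phiE m b : 0 < b -> phi m b = normal_pdf m (Num.sqrt b).
Proof.
move=> b0; apply/funext => x; rewrite normal_pdfE ?gt_eqF ?sqrtr_gt0//.
rewrite /normal_peak /normal_fun sqr_sqrtr ?ltW// /phi; congr (_^-1 * expR (_ / _)).
  by congr Num.sqrt; ring.
by ring.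
Qed.

Lemma measurable_phi m b : measurable_fun setT (phi m b).
Proof.
apply: measurable_funM => //; apply: measurableT_comp => //; apply: measurable_funM => //.
by apply: measurableT_comp => //; apply: measurable_funX; exact: measurable_funB.
Qed.

Lemma integral_phi m b : 0 < b -> (\int[lebesgue_measure]_x (phi m b x)%:E = 1)%E.
Proof. by move=> b0; rewrite phiE// integral_normal_pdf. Qed.

Lemma integrable_phi m b : 0 < b ->
  (@lebesgue_measure R).-integrable setT (EFin \o phi m b).
Proof. by move=> b0; rewrite phiE//; exact: integrable_normal_pdf. Qed.

Lemma phi_shift m b x : phi m b x = phi 0 b (x - m).
Proof. by rewrite /phi subr0. Qed.

Lemma is_derive_phi_scale b (y a : R) : 0 < b ->
  is_derive a 1 (fun a => phi 0 b (a * y)) (- (a * y ^+ 2 / b) * phi 0 b (a * y)).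
Proof.
move=> b0; rewrite /phi.
apply: is_derive_eq.
rewrite /= !scaler1 /GRing.scale /= !subr0.
by field; rewrite ?gt_eqF// sqrtr_gt0 !mulr_gt0 ?pi_gt0.
Qed.

(** Domination for differentiating in [a] near 1. With z = y^2 / (16 b), the polynomial factor is 16
    a z and the exponent is - 8 a^2 z <= - 2 z, since a > 1/2. As z exp(-z) <= 1 and a < 3/2, the
    product is at most 24 exp(-z), and exp(-z) is the exponential of a Gaussian of variance 8 b. The
    quotient of roots exchanges the normalising constants. *)
Lemma phi_scale_bound b (y a : R) : 0 < b -> 1/2 < a < 3/2 ->
  `|- (a * y ^+ 2 / b) * phi 0 b (a * y)| <=
  24 * (Num.sqrt (2 * pi * (8 * b)) / Num.sqrt (2 * pi * b)) * phi 0 (8 * b) y.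
Proof.
move=> b0 /andP[a1 a2].
have s0 c : 0 < c -> 0 < Num.sqrt (2 * pi * c) :> R.
  by move=> c0; rewrite sqrtr_gt0 !mulr_gt0 ?pi_gt0.
have a0 : 0 < a by lra.
have y0 : 0 <= y ^+ 2 / b by rewrite divr_ge0 ?sqr_ge0// ltW.
rewrite normrM normrN !ger0_norm ?phi_ge0//; last first.
  by rewrite -mulrA mulr_ge0// ltW.
rewrite /phi !subr0.
have -> : 24 * (Num.sqrt (2 * pi * (8 * b)) / Num.sqrt (2 * pi * b)) *
   ((Num.sqrt (2 * pi * (8 * b)))^-1 * expR (- y ^+ 2 / (2 * (8 * b)))) =
   (Num.sqrt (2 * pi * b))^-1 * (24 * expR (- y ^+ 2 / (2 * (8 * b)))).
  by field; rewrite !gt_eqF ?s0// mulr_gt0.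
rewrite mulrCA ler_pM2l ?invr_gt0 ?s0//.
set z := y ^+ 2 / b / 16.
have z0 : 0 <= z by rewrite divr_ge0.
have -> : a * y ^+ 2 / b = 16 * a * z by rewrite /z; field; rewrite gt_eqF.
have -> : - y ^+ 2 / (2 * (8 * b)) = - z by rewrite /z; field; rewrite gt_eqF.
have -> : - (a * y) ^+ 2 / (2 * b) = - (8 * a ^+ 2 * z) by rewrite /z; field; rewrite gt_eqF.
move: z0; clearbody z => z0.
have e1 : expR (- (8 * a ^+ 2 * z)) <= expR (- z) * expR (- z).
  rewrite -expRD ler_expR; have : 2 <= 8 * a ^+ 2 by nra.
  by move=> h; nra.
have e2 : z * expR (- z) <= 1.
  rewrite -(@ler_pM2r _ (expR z)) ?expR_gt0// mul1r -mulrA -expRD addNr expR0 mulr1.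
  by apply: le_trans (expR_ge1Dx z); lra.
have e3 : 0 < expR (- z) by exact: expR_gt0.
apply: (@le_trans _ _ (16 * a * z * (expR (- z) * expR (- z)))).
  by rewrite ler_wpM2l// !mulr_ge0// ltW.
apply: (@le_trans _ _ (16 * a * expR (- z))); last by rewrite ler_wpM2r ?ltW//; lra.
have -> : 16 * a * z * (expR (- z) * expR (- z)) = (16 * a * expR (- z)) * (z * expR (-z)) by ring.
by rewrite ler_piMr// !mulr_ge0// ltW.
Qed.

(* Differentiate [\int phi 0 b (a * y) dy = 1 / a] in [a] at [a = 1]. *)
Lemma integral_phi_var0 b : 0 < b ->
  (\int[lebesgue_measure]_x (phi 0 b x * x ^+ 2)%:E = b%:E)%E.
Proof.
move=> b0.
pose f (a y : R) := phi 0 b (a * y).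
pose K := 24 * (Num.sqrt (2 * pi * (8 * b)) / Num.sqrt (2 * pi * b)).
have K0 : 0 <= K by rewrite mulr_ge0// divr_ge0// sqrtr_ge0.
have b8 : 0 < 8 * b by rewrite mulr_gt0.
pose G y := K * phi 0 (8 * b) y.
have G0 y : 0 <= G y by rewrite mulr_ge0// phi_ge0.
have iG : (@lebesgue_measure R).-integrable setT (EFin \o G).
  rewrite /G /comp; under eq_fun do rewrite EFinM.
  by apply: integrableZl => //; exact: integrable_phi.
have If a : 0 < a -> (\int[lebesgue_measure]_y (f a y)%:E = (a^-1)%:E)%E.
  move=> a0; transitivity (\int[lebesgue_measure]_y (phi 0 b (a * y + 0))%:E)%E.
    by apply: eq_integral => y _; rewrite addr0.
  rewrite (ge0_integral_affine1 _ a0 (f := fun x => (phi 0 b x)%:E)) ?integral_phi ?mule1//.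
    by apply/measurable_EFinP; exact: measurable_phi.
  by move=> x; rewrite lee_fin phi_ge0.
have mf a : measurable_fun setT (f a).
  by apply: measurableT_comp; [exact: measurable_phi|exact: measurable_funM].
have intf (x : R) : `]1/2, 3/2[%classic x ->
    (@lebesgue_measure R).-integrable setT (EFin \o f x).
  rewrite /= in_itv /= => /andP[x1 x2]; apply/integrableP; split.
    by apply/measurable_EFinP; exact: mf.
  under eq_integral do rewrite /= ger0_norm ?phi_ge0//.
  by rewrite If ?ltry//; lra.
have I1 : `]1/2 : R, 3/2[%classic (1 : R) by rewrite /= in_itv /=; apply/andP; split; lra.
have d1E (x y : R) : partial1of2 f x y = - (x * y ^+ 2 / b) * phi 0 b (x * y).
  by rewrite partial1of2E; have := @is_derive_phi_scale b y x b0 => /(@derive_val _ _ _ _ _ _ _).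
have D := @differentiation_under_integral R _ _ (@lebesgue_measure R) f setT measurableT
  1 (1/2) (3/2) I1 intf (fun x y _ _ => @ex_derive _ _ _ _ _ _ _ (@is_derive_phi_scale b y x b0))
  G G0 iG.
pose h y := y ^+ 2 / b * phi 0 b y.
have h0 y : 0 <= h y by rewrite mulr_ge0 ?phi_ge0// divr_ge0 ?sqr_ge0// ltW.
have mh : measurable_fun setT h.
  apply: measurable_funM; last exact: measurable_phi.
  by apply: measurable_funM => //; exact: measurable_funX.
have ih : (@lebesgue_measure R).-integrable setT (EFin \o h).
  apply: le_integrable iG => //; first by apply/measurable_EFinP; exact: mh.
  move=> y _; rewrite /= lee_fin !ger0_norm//.
  have := @phi_scale_bound b y 1 b0; rewrite !mul1r mulNr normrN ger0_norm ?h0//; apply.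
  by apply/andP; split; lra.
have {}D : - (1 : R) = \int[lebesgue_measure]_y (-1 * h y).
  transitivity ((fun x' => \int[lebesgue_measure]_(y in setT) f x' y)^`()%classic 1).
    rewrite derive1E (near_eq_derive (g := fun x : R => x^-1)).
      by rewrite deriveV// derive_id expr1n invr1 scaler1.
    near=> x; rewrite /Rintegral If//.
    by near: x; exact: lt_nbhsr.
  rewrite D; last first.
    move=> x y; rewrite /= in_itv/= => /andP[x1 x2] _; rewrite d1E.
    by apply: phi_scale_bound => //; apply/andP.
  by apply: eq_Rintegral => y _; rewrite d1E !mul1r mulNr /h mulNr mul1r.
move: D; rewrite RintegralZl// => /eqP; rewrite mulN1r eqr_opp => /eqP D.
have Ih : (\int[lebesgue_measure]_x (h x)%:E = 1)%E.
  by rewrite -[RHS]/(1%:E) D fineK//; exact: integrable_fin_num.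
transitivity (\int[lebesgue_measure]_x (b%:E * (h x)%:E))%E.
  apply: eq_integral => x _; rewrite -EFinM; congr (_%:E).
  by rewrite /h; field; rewrite gt_eqF.
by rewrite integralZl// Ih mule1.
Unshelve. all: by end_near. Qed.

(* Averaging over the reflection [x |-> 2 m - x] removes the cross term, so that no signed
   integral is needed for the noncentral second moment. *)
Lemma phi_reflect_sq m b v (x : R) :
  phi m b x * (x - v) ^+ 2 + phi m b (2 * m - x) * (2 * m - x - v) ^+ 2 =
  2 * (phi m b x * (x - m) ^+ 2) + 2 * (m - v) ^+ 2 * phi m b x.
Proof.
have -> : phi m b (2 * m - x) = phi m b x.
  rewrite /phi (_ : 2 * m - x - m = - (x - m)) ?sqrrN//.
  by rewrite mulr_natl mulr2n addrAC addrK opprB.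
move: (phi m b x) => p; ring.
Qed.

Lemma integral_phi_var m b v : 0 < b ->
  (\int[lebesgue_measure]_x (phi m b x * (x - v) ^+ 2)%:E = (b + (m - v) ^+ 2)%:E)%E.
Proof.
move=> b0.
have mf w : measurable_fun setT (fun x : R => (phi m b x * (x - w) ^+ 2)%:E).
  apply/measurable_EFinP; apply: measurable_funM; first exact: measurable_phi.
  by apply: measurable_funX; exact: measurable_funB.
have f0 w (x : R) : (0 <= (phi m b x * (x - w) ^+ 2)%:E)%E.
  by rewrite lee_fin mulr_ge0 ?phi_ge0 ?sqr_ge0.
have Im : (\int[lebesgue_measure]_x (phi m b x * (x - m) ^+ 2)%:E = b%:E)%E.
  pose g (x : R) := (phi 0 b x * x ^+ 2)%:E.
  transitivity (\int[lebesgue_measure]_x g (1 * x - m)%R)%E.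
    by apply: eq_integral => x _; rewrite /g mul1r -phi_shift.
  rewrite ge0_integral_affine1//.
  - by rewrite invr1 mul1e integral_phi_var0.
  - apply/measurable_EFinP; apply: measurable_funM; first exact: measurable_phi.
    exact: measurable_funX.
  - by move=> x; rewrite lee_fin mulr_ge0 ?phi_ge0 ?sqr_ge0.
set I := (X in X = _).
have II : (I + I = (2 * (b + (m - v) ^+ 2))%:E)%E.
  rewrite {2}/I -(ge0_integral_reflect1 (2 * m) (mf v))// /I -ge0_integralTD//; first last.
  - by apply: (measurableT_comp (mf v)); exact: measurable_funB.
  - exact: mf.
  transitivity (\int[lebesgue_measure]_x ((2%:E * (phi m b x * (x - m) ^+ 2)%:E) +
     ((2 * (m - v) ^+ 2)%:E * (phi m b x)%:E)))%E.
    by apply: eq_integral => x _; rewrite -!EFinM -!EFinD phi_reflect_sq.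
  have mp : measurable_fun setT (fun x : R => (phi m b x)%:E).
    by apply/measurable_EFinP; exact: measurable_phi.
  have p0 x : (0 <= (phi m b x)%:E)%E by rewrite lee_fin phi_ge0.
  have w0 : 0 <= 2 * (m - v) ^+ 2 by rewrite mulr_ge0// sqr_ge0.
  rewrite ge0_integralTD.
  - rewrite ge0_integralTZl//; last exact: mf.
    rewrite ge0_integralTZl// Im integral_phi// -!EFinM -EFinD.
    by congr (_%:E); ring.
  - by apply: measurable_funeM; exact: mf.
  - by move=> x; rewrite mule_ge0// f0.
  - by apply: measurable_funeM; exact: mp.
  - by move=> x; rewrite mule_ge0.
(* An infinite [I] would contradict the finite value of [I + I]; for a real [I] the factor 2
   cancels. *)
case: I II => [r [e]| |]//; congr (_%:E).
by apply: (@mulfI _ 2); rewrite ?pnatr_eq0// -e; ring.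
Qed.

End Gauss1.

(** * Isotropic Gaussians on R^d *)

Section GaussD.
Context {R : realType}.

Definition rvtl k (m : 'rV[R]_k.+1) : 'rV[R]_k := \row_i m 0 (lift ord0 i).

Lemma sqnorm_cons k (m : 'rV[R]_k.+1) (x : R) (t : k.-tuple R) :
  sqnorm (rv (cons_tuple x t : k.+1.-tuple R) - m) =
  (x - m 0 0) ^+ 2 + sqnorm (rv t - rvtl m).
Proof.
rewrite /sqnorm big_ord_recl; congr (_ + _).
  by rewrite !mxE tnth0.
by apply: eq_bigr => i _; rewrite !mxE tnthS.
Qed.

Lemma gauss_pdf_cons k (m : 'rV[R]_k.+1) b (x : R) (t : k.-tuple R) :
  gauss_pdf m b (rv (cons_tuple x t : k.+1.-tuple R)) =
  phi (m 0 0) b x * gauss_pdf (rvtl m) b (rv t).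
Proof.
rewrite /gauss_pdf /phi sqnorm_cons exprS.
set A := (x - m 0 0) ^+ 2; set B := sqnorm _.
have -> : - (A + B) / (2 * b) = - A / (2 * b) + - B / (2 * b) by rewrite opprD mulrDl.
by rewrite expRD (invfM (Num.sqrt _)) mulrACA.
Qed.

Lemma measurable_gauss_pdf_rv k (m : 'rV[R]_k) b :
  measurable_fun setT (fun t : k.-tuple R => gauss_pdf m b (rv t)).
Proof. by apply: measurable_gauss_pdf; [exact: vmeas_cst|exact: vmeas_rv]. Qed.

Lemma integral_gauss_pdf k (m : 'rV[R]_k) b : 0 < b ->
  (\int[@lebRd R k]_t (gauss_pdf m b (rv t))%:E = 1)%E.
Proof.
move=> b0; elim: k m => [|k IH] m.
  rewrite integral_lebRd0; last first.
    by apply/measurable_EFinP; exact: measurable_gauss_pdf_rv.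
  by rewrite /gauss_pdf /sqnorm big_ord0 expr0 invr1 mul1r oppr0 mul0r expR0.
rewrite integral_lebRdS; first last.
- by move=> t; rewrite lee_fin gauss_pdf_ge0.
- by apply/measurable_EFinP; exact: measurable_gauss_pdf_rv.
rewrite -(integral_phi (m 0 0) b0); apply: eq_integral => x _.
under eq_integral do rewrite gauss_pdf_cons EFinM.
rewrite ge0_integralTZl ?phi_ge0//.
- by rewrite IH mule1.
- by apply/measurable_EFinP; exact: measurable_gauss_pdf_rv.
- by move=> t; rewrite lee_fin gauss_pdf_ge0.
Qed.

Lemma integral_gauss_sqnorm k (m v : 'rV[R]_k) b : 0 < b ->
  (\int[@lebRd R k]_t (gauss_pdf m b (rv t) * sqnorm (rv t - v))%:E =
   (k%:R * b + sqnorm (m - v))%:E)%E.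
Proof.
move=> b0; elim: k m v => [|k IH] m v.
  rewrite integral_lebRd0; last first.
    apply/measurable_EFinP; apply: measurable_funM; first exact: measurable_gauss_pdf_rv.
    by apply: measurable_sqnorm; apply: vmeasB; [exact: vmeas_rv|exact: vmeas_cst].
  by rewrite /sqnorm !big_ord0 mul0r mulr0 add0r.
have mS j (w u : 'rV[R]_j) :
    measurable_fun setT (fun t : j.-tuple R => (gauss_pdf w b (rv t) * sqnorm (rv t - u))%:E).
  apply/measurable_EFinP; apply: measurable_funM; first exact: measurable_gauss_pdf_rv.
  by apply: measurable_sqnorm; apply: vmeasB; [exact: vmeas_rv|exact: vmeas_cst].
have mP j (w : 'rV[R]_j) : measurable_fun setT (fun t : j.-tuple R => (gauss_pdf w b (rv t))%:E).
  by apply/measurable_EFinP; exact: measurable_gauss_pdf_rv.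
rewrite integral_lebRdS//; last first.
  by move=> t; rewrite lee_fin mulr_ge0 ?gauss_pdf_ge0 ?sqnorm_ge0.
set c := k%:R * b + sqnorm (rvtl m - rvtl v).
have c0 : 0 <= c by rewrite addr_ge0 ?sqnorm_ge0// mulr_ge0// ltW.
transitivity (\int[lebesgue_measure]_x ((phi (m 0 0) b x * (x - v 0 0) ^+ 2)%:E +
    c%:E * (phi (m 0 0) b x)%:E))%E.
  apply: eq_integral => x _.
  transitivity (\int[@lebRd R k]_t (
      (phi (m 0 0) b x * (x - v 0 0) ^+ 2)%:E * (gauss_pdf (rvtl m) b (rv t))%:E +
      (phi (m 0 0) b x)%:E * (gauss_pdf (rvtl m) b (rv t) * sqnorm (rv t - rvtl v))%:E))%E.
    apply: eq_integral => t _; rewrite gauss_pdf_cons sqnorm_cons -!EFinM -EFinD.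
    by congr (_%:E); ring.
  rewrite ge0_integralTD.
  - rewrite ge0_integralTZl; first last.
    + by move=> t; rewrite lee_fin gauss_pdf_ge0.
    + exact: mP.
    + by rewrite mulr_ge0 ?phi_ge0 ?sqr_ge0.
    rewrite integral_gauss_pdf// mule1 ge0_integralTZl ?phi_ge0//; first last.
    + by move=> t; rewrite lee_fin mulr_ge0 ?gauss_pdf_ge0 ?sqnorm_ge0.
    + exact: mS.
    by rewrite IH muleC.
  - by apply: measurable_funeM; exact: mP.
  - move=> t; rewrite -EFinM lee_fin mulr_ge0 ?gauss_pdf_ge0//.
    by rewrite mulr_ge0 ?phi_ge0 ?sqr_ge0.
  - by apply: measurable_funeM; exact: mS.
  - move=> t; rewrite -EFinM lee_fin mulr_ge0 ?phi_ge0//.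
    by rewrite mulr_ge0 ?gauss_pdf_ge0 ?sqnorm_ge0.
have mp : measurable_fun setT (fun x : R => (phi (m 0 0) b x)%:E).
  by apply/measurable_EFinP; exact: measurable_phi.
rewrite ge0_integralTD.
- rewrite integral_phi_var// ge0_integralTZl//; last first.
    by move=> x; rewrite lee_fin phi_ge0.
  rewrite integral_phi// mule1 -EFinD; congr (_%:E).
  rewrite /c (_ : sqnorm (m - v) = (m 0 0 - v 0 0) ^+ 2 + sqnorm (rvtl m - rvtl v)).
    by rewrite -natr1; ring.
  rewrite /sqnorm big_ord_recl; congr (_ + _); first by rewrite !mxE.
  by apply: eq_bigr => i _; rewrite !mxE.
- apply/measurable_EFinP; apply: measurable_funM; first exact: measurable_phi.
  by apply: measurable_funX; exact: measurable_funB.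
- by move=> x; rewrite lee_fin mulr_ge0 ?phi_ge0 ?sqr_ge0.
- by apply: measurable_funeM; exact: mp.
- by move=> x; rewrite mule_ge0// lee_fin phi_ge0.
Qed.

Definition emeas k (F : 'rV[R]_k -> \bar R) :=
  measurable_fun setT (fun t : k.-tuple R => F (rv t)).

Lemma emeas_comp k (F : 'rV[R]_k -> \bar R) dS (S : measurableType dS) (h : S -> 'rV[R]_k) :
  emeas F -> vmeas h -> measurable_fun setT (fun s => F (h s)).
Proof.
move=> mF mh; rewrite (_ : (fun s => _) = (fun t => F (rv t)) \o (fun s => tuple_of_rv (h s))).
  exact: measurableT_comp mF (vmeas_tuple mh).
by apply/funext => s /=; rewrite tuple_of_rvK.
Qed.

(** Density of the image of N(m, b) under an affine map, with Jacobian [c ^+ k]; it serves the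
    degenerate case of [gauss_int_conv]. *)
Lemma gauss_pdf_scale k (m m' x : 'rV[R]_k) (b c : R) : 0 < c -> 0 < b ->
  gauss_pdf m b x = c ^+ k * gauss_pdf m' (c ^+ 2 * b) (m' + c *: (x - m)).
Proof.
move=> c0 b0; rewrite /gauss_pdf [RHS]mulrA; congr (_ * expR _).
  rewrite (_ : 2 * pi * (c ^+ 2 * b) = c ^+ 2 * (2 * pi * b)); last by ring.
  rewrite (sqrtrM _ (sqr_ge0 c)) sqrtr_sqr gtr0_norm// exprMn invfM mulrA mulfV ?mul1r//.
  by rewrite expf_neq0// gt_eqF.
rewrite (addrC m') addrK sqnormZ; field.
by rewrite !gt_eqF.
Qed.

(* Completing the square: Bayes' rule for x ~ N(m, b) and y ~ N(m' + c (x - m), l). *)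
Lemma gauss_pdf_mul k (m m' x y : 'rV[R]_k) (b c l : R) : 0 < b -> 0 < l ->
  gauss_pdf m b x * gauss_pdf (m' + c *: (x - m)) l y =
  gauss_pdf m' (c ^+ 2 * b + l) y *
  gauss_pdf (m + (c * b / (c ^+ 2 * b + l)) *: (y - m')) (l * b / (c ^+ 2 * b + l)) x.
Proof.
move=> b0 l0; have L0 : 0 < c ^+ 2 * b + l by rewrite ltr_wpDl// mulr_ge0 ?sqr_ge0// ltW.
have s0 e : 0 < e -> 0 <= 2 * pi * e :> R by move=> e0; rewrite !mulr_ge0 ?pi_ge0// ltW.
rewrite /gauss_pdf mulrACA [RHS]mulrACA -!expRD -!invfM -!exprMn -!sqrtrM ?s0//.
have -> : 2 * pi * (c ^+ 2 * b + l) * (2 * pi * (l * b / (c ^+ 2 * b + l))) =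
          2 * pi * b * (2 * pi * l) by field; rewrite gt_eqF.
congr (_ * expR _).
rewrite /sqnorm !mulNr -!opprD; congr (- _); rewrite !mulr_suml -!big_split /=.
apply: eq_bigr => i _; rewrite !mxE; field.
by rewrite !gt_eqF.
Qed.

(** If x ~ N(m, b) and, given x, y ~ N(m' + c (x - m), l), then y ~ N(m', c^2 b + l). The values
    [c = 0] and [l = 0] are both allowed, since [lam n ^+ 2] ranges over the closed interval from 0
    to [bbar beta n.-1]. *)
Lemma gauss_int_conv k (m m' : 'rV[R]_k) (b c l : R) (F : 'rV[R]_k -> \bar R) :
  0 < b -> 0 <= c -> 0 <= l -> 0 < c ^+ 2 * b + l ->
  emeas F -> (forall x, 0 <= F x)%E ->
  gauss_int m b (fun x => gauss_int (m' + c *: (x - m)) l F) =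
  gauss_int m' (c ^+ 2 * b + l) F.
Proof.
move=> b0 c0 l0 L0 mF F0; rewrite /gauss_int !(gt_eqF b0) !(gt_eqF L0).
(* A Dirac transition has no density to which Bayes' rule applies. Here [L0] forces [c > 0], and the
   claim is an affine change of variables. *)
have [le0|/negbTE ln0] := eqVneq l 0.
  have {}c0 : 0 < c.
    rewrite lt_neqAle c0 andbT; apply: contraTneq L0 => <-.
    by rewrite le0 expr0n /= mul0r addr0 ltxx.
  rewrite le0 addr0.
  pose H (t : k.-tuple R) := ((gauss_pdf m' (c ^+ 2 * b) (rv t))%:E * F (rv t))%E.
  have mH : measurable_fun setT H.
    apply: emeasurable_funM => //; apply/measurable_EFinP; exact: measurable_gauss_pdf_rv.
  have H0 t : (0 <= H t)%E by rewrite mule_ge0// lee_fin gauss_pdf_ge0.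
  transitivity (\int[@lebRd R k]_t ((c ^+ k)%:E *
      H (affine_tuple c (tuple_of_rv (m' - c *: m)) t)))%E.
    apply: eq_integral => t _; rewrite /H /affine_tuple !tuple_of_rvK muleA -EFinM.
    rewrite (_ : c *: rv t + _ = m' + c *: (rv t - m)); last first.
      by rewrite scalerBr addrCA.
    by rewrite -gauss_pdf_scale.
  rewrite ge0_integralTZl; first last.
  - by move=> t; exact: H0.
  - exact: measurableT_comp mH (measurable_affine_tuple _ _).
  - by rewrite exprn_ge0// ltW.
  rewrite integral_lebRd_affine// muleA -EFinM mulfV ?mul1e//.
  by rewrite expf_neq0// gt_eqF.
have {}l0 : 0 < l by rewrite lt_neqAle l0 eq_sym ln0.
have mpair (h : k.-tuple R * k.-tuple R -> k.-tuple R) : measurable_fun setT h ->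
    vmeas (fun p => rv (h p)) by exact: vmeas_rv_comp.
have m1 := mpair _ measurable_fst; have m2 := mpair _ measurable_snd.
pose w := l * b / (c ^+ 2 * b + l).
have w0 : 0 < w by rewrite divr_gt0// mulr_gt0.
transitivity (\int[@lebRd R k]_x \int[@lebRd R k]_y
   (((gauss_pdf m b (rv x) * gauss_pdf (m' + c *: (rv x - m)) l (rv y))%:E * F (rv y))))%E.
  apply: eq_integral => x _; rewrite -ge0_integralZl_EFin ?gauss_pdf_ge0//.
  - by apply: eq_integral => y _; rewrite muleA -EFinM.
  - by move=> y _; rewrite mule_ge0// lee_fin gauss_pdf_ge0.
  - apply: emeasurable_funM => //; apply/measurable_EFinP; exact: measurable_gauss_pdf_rv.
(* Once the integral over [x] is inside, [gauss_pdf_mul] leaves there a Gaussian density in [x],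
   whose mass is one. *)
rewrite (fubini_tonelli (fun p : k.-tuple R * k.-tuple R =>
   ((gauss_pdf m b (rv p.1) * gauss_pdf (m' + c *: (rv p.1 - m)) l (rv p.2))%:E * F (rv p.2))%E)).
- apply: eq_integral => y _ /=.
  under eq_integral do rewrite gauss_pdf_mul// EFinM -muleA muleCA muleC.
  rewrite ge0_integralZl//.
  + rewrite integral_gauss_pdf//.
    by rewrite mule1 muleC.
  + by apply/measurable_EFinP; exact: measurable_gauss_pdf_rv.
  + by move=> x _; rewrite lee_fin gauss_pdf_ge0.
- by rewrite mule_ge0// lee_fin gauss_pdf_ge0.
- apply: emeasurable_funM; last exact: emeas_comp.
  apply/measurable_EFinP; apply: measurable_funM.
    by apply: measurable_gauss_pdf => //; exact: vmeas_cst.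
  apply: measurable_gauss_pdf => //; apply: vmeasD; first exact: vmeas_cst.
  by apply: vmeasZ; apply: vmeasB => //; exact: vmeas_cst.
- by move=> p; rewrite mule_ge0// lee_fin mulr_ge0 ?gauss_pdf_ge0.
Qed.

End GaussD.

(** * Monotone functionals and Markov chains *)

Section Daniell.
Context {R : realType} {dT : measure_display} {T : measurableType dT}.
Local Open Scope ereal_scope.

Definition nnm (f : T -> \bar R) := measurable_fun setT f /\ forall x, 0 <= f x.

(** The rules of integration for nonnegative measurable functions, monotone convergence included.
    They let iterated Gaussian integrals be manipulated before any measure is known to represent
    them. *)
Record daniell (E : (T -> \bar R) -> \bar R) : Prop := {
  dan_ge0 : forall f, (forall x, 0 <= f x) -> 0 <= E f;
  dan_add : forall f g, nnm f -> nnm g -> E (fun x => f x + g x) = E f + E g;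
  dan_scale : forall (c : R) f, (0 <= c)%R -> nnm f -> E (fun x => c%:E * f x) = c%:E * E f;
  dan_le : forall f g, nnm f -> nnm g -> (forall x, f x <= g x) -> E f <= E g;
  dan_lim : forall g : nat -> T -> \bar R, (forall n, nnm (g n)) ->
    (forall x, {homo (g ^~ x) : n m / (n <= m)%N >-> n <= m}) ->
    E (fun x => limn (g ^~ x)) = limn (fun n => E (g n)) }.

Lemma daniell_integral (m : {measure set T -> \bar R}) :
  daniell (fun f => \int[m]_x f x).
Proof.
split.
- by move=> f f0; apply: integral_ge0.
- by move=> f g [mf f0] [mg g0]; rewrite ge0_integralTD.
- by move=> c f c0 [mf f0]; rewrite ge0_integralTZl.
- by move=> f g [mf f0] [mg g0] fg; apply: ge0_le_integralT.
- move=> g mg ng; rewrite monotone_convergence//.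
  + by move=> n; have [] := mg n.
  + by move=> n x _; have [_] := mg n.
Qed.

Lemma nnm_indic (A : set T) : measurable A -> nnm (fun x => (\1_A x : R)%:E).
Proof.
by move=> mA; split=> [|x]; [apply/measurable_EFinP; exact: measurable_indic|rewrite lee_fin].
Qed.

Import HBNNSimple.

(** Additivity and scaling pass from indicators to simple functions, written as sums over a list so
    that induction applies; [dan_lim] then reaches every nonnegative measurable function. *)
Lemma daniell_eq E1 E2 : daniell E1 -> daniell E2 ->
  (forall A, measurable A -> E1 (fun x => (\1_A x : R)%:E) = E2 (fun x => (\1_A x : R)%:E)) ->
  forall f, nnm f -> E1 f = E2 f.
Proof.
move=> D1 D2 E12 f [mf f0].
have simp (s : seq R) (A : R -> set T) : (forall y, measurable (A y)) ->
    (forall y, y \in s -> 0 <= y)%R ->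
    nnm (fun x => (\sum_(y <- s) y * \1_(A y) x)%R%:E) /\
    E1 (fun x => (\sum_(y <- s) y * \1_(A y) x)%R%:E) =
    E2 (fun x => (\sum_(y <- s) y * \1_(A y) x)%R%:E).
  move=> mA; elim: s => [|y s IH] s0.
    have e E : daniell E -> E (fun x => (\sum_(y <- [::]) y * \1_(A y) x)%R%:E) = 0.
      move=> D; have := @dan_scale _ D 0%R (cst 0) (lexx _).
      rewrite mul0e => <-; last by split.
      by congr E; apply/funext => x; rewrite big_nil mule0.
    split; last by rewrite !e.
    by split=> [|x]; [under eq_fun do rewrite big_nil; exact: measurable_cst|rewrite big_nil].
  have [nns IHs] := IH (fun z zs => s0 z (mem_behead (s := y :: s) zs)).
  have y0 : (0 <= y)%R by apply: s0; rewrite mem_head.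
  have nny : nnm (fun x => y%:E * (\1_(A y) x : R)%:E).
    have [? ?] := nnm_indic (mA y).
    by split=> [|x]; [exact: measurable_funeM|exact: mule_ge0].
  have -> : (fun x => (\sum_(z <- y :: s) z * \1_(A z) x)%R%:E) =
            (fun x => y%:E * (\1_(A y) x : R)%:E + (\sum_(z <- s) z * \1_(A z) x)%R%:E).
    by apply/funext => x; rewrite big_cons EFinD EFinM.
  split.
    have [? ?] := nny; have [? ?] := nns.
    by split=> [|x]; [exact: emeasurable_funD|exact: adde_ge0].
  rewrite (dan_add D1)// (dan_add D2)// IHs (dan_scale D1)//; last exact: nnm_indic.
  by rewrite (dan_scale D2)//; [rewrite E12|exact: nnm_indic].
have sf (h : {nnsfun T >-> R}) : nnm (EFin \o h) /\ E1 (EFin \o h) = E2 (EFin \o h).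
  have hE : EFin \o h = fun x =>
      (\sum_(y <- finmap.enum_fset (fset_set (range h))) y * \1_(h @^-1` [set y]) x)%R%:E.
    apply/funext => x /=; rewrite fimfunE fsbig_finite//; exact: fimfunP.
  rewrite hE; apply: simp => [y|y]; first exact: measurable_sfunP.
  rewrite in_fset_set; last exact: fimfunP.
  by rewrite inE => -[x _ <-]; exact: fun_ge0.
pose h := nnsfun_approx measurableT mf.
have -> : f = fun x => limn (fun n => (EFin \o h n) x).
  apply/funext => x; apply/esym/cvg_lim => //.
  by apply: (cvg_nnsfun_approx measurableT mf) => // y _; exact: f0.
have nd x : {homo (fun n => (EFin \o h n) x) : n m / (n <= m)%N >-> n <= m}.
  by move=> n m nm /=; rewrite lee_fin; exact/lefP/(nd_nnsfun_approx measurableT mf).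
rewrite (dan_lim D1 (g := fun n => EFin \o h n)) ?(dan_lim D2 (g := fun n => EFin \o h n))//.
- by congr (limn _); apply/funext => n; have [] := sf (h n).
- by move=> n; have [] := sf (h n).
- by move=> n; have [] := sf (h n).
Qed.

(** Countable additivity is [dan_lim] for the partial sums of the indicators of the disjoint
    sets. *)
Lemma daniell_measure E : daniell E ->
  exists m : {measure set T -> \bar R},
    (m : set T -> \bar R) = (fun A => E (fun x => (\1_A x : R)%:E)) /\
    forall f, nnm f -> \int[m]_x f x = E f.
Proof.
move=> D; pose m0 (A : set T) := E (fun x => (\1_A x : R)%:E).
have m00 : m0 set0 = 0.
  have := @dan_scale _ D 0%R (cst 0) (lexx _).
  rewrite mul0e => <-; last by split.
  by congr E; apply/funext => x; rewrite indic0 mule0.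
have m0_ge0 A : 0 <= m0 A by apply: (dan_ge0 D) => x; rewrite lee_fin.
have m0_add : semi_sigma_additive m0.
  move=> F mF tF mUF.
  pose g n x := \sum_(0 <= i < n) (\1_(F i) x : R)%:E.
  have g_nnm n : nnm (g n).
    split=> [|x]; last by apply: sume_ge0 => i _; rewrite lee_fin.
    by apply: emeasurable_sum => i; have [] := nnm_indic (mF i).
  have ndg x : {homo (g ^~ x) : n m / (n <= m)%N >-> n <= m}.
    by apply: ereal_nondecreasing_series => i _ _; rewrite lee_fin.
  have gE n : E (g n) = \sum_(0 <= i < n) m0 (F i).
    elim: n => [|n IH].
      rewrite big_geq//; rewrite -[RHS]m00; congr E; apply/funext => x.
      by rewrite /g big_geq// indic0.
    rewrite big_nat_recr//= -IH -(dan_add D)//; last exact: nnm_indic.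
    by congr E; apply/funext => x; rewrite /g big_nat_recr.
  rewrite (_ : m0 (\bigcup_n F n) = limn (fun n => \sum_(0 <= i < n) m0 (F i))).
    by apply: is_cvg_nneseries => i _ _; exact: m0_ge0.
  transitivity (limn (fun n => E (g n))); last by congr (limn _); apply/funext => n; exact: gE.
  rewrite -(dan_lim D)//; congr E; apply/funext => x; apply/esym/cvg_lim => //.
  (* At a fixed [x], the statement that the indicators of disjoint sets sum to that of their union
     is sigma-additivity of the Dirac measure at [x]. *)
  have := @measure_semi_sigma_additive _ _ _ (@dirac _ T x R) F mF tF mUF.
  by rewrite /dirac.
pose m : {measure set T -> \bar R} :=
  HB.pack m0 (isMeasure.Build _ _ _ m0 m00 m0_ge0 m0_add).
exists m; split=> // f nf.
apply: (daniell_eq (daniell_integral m) D _ nf) => A mA.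
by rewrite integral_indic// setIT.
Qed.

End Daniell.

Lemma measurable_funV_gt0 (R : realType) dT (T : measurableType dT) (f : T -> R) :
  measurable_fun setT f -> (forall x, 0 < f x) -> measurable_fun setT (fun x => (f x)^-1).
Proof.
move=> mf f0; rewrite (_ : (fun x => _) = fun x => expR (- ln (f x))).
  apply: measurableT_comp => //; apply: measurableT_comp => //.
  exact: measurableT_comp.
by apply/funext => x; rewrite expRN lnK// posrE.
Qed.

(** * Transition kernels on paths, and the two chains *)

Section Pker.
Context {R : realType} {d : nat}.
Notation path := (nat -> 'rV[R]_d).
Local Open Scope ereal_scope.

Definition ameas dS (S : measurableType dS) (a : S -> path) :=
  forall j, vmeas (fun s => a s j).

(* Path functionals are called measurable when they are so along every measurable
   family of paths, which avoids choosing a sigma-algebra on nat -> R^d. *)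
Definition pmeas (h : path -> \bar R) :=
  forall dS (S : measurableType dS) (a : S -> path), ameas a ->
    measurable_fun setT (fun s => h (a s)).

Definition pnn (h : path -> \bar R) := pmeas h /\ forall a, 0 <= h a.

Definition pvmeas (m : path -> 'rV[R]_d) :=
  forall dS (S : measurableType dS) (a : S -> path), ameas a -> vmeas (fun s => m (a s)).

(** A kernel seen as an operator on functionals: for each starting path a monotone functional as in
    [daniell], depending measurably on the path. This is stable under composition, so both chains
    inherit it from their single steps. *)
Record pker (K : path -> (path -> \bar R) -> \bar R) : Prop := {
  pk_ge0 : forall a g, (forall b, 0 <= g b) -> 0 <= K a g;
  pk_meas : forall g, pnn g -> pmeas (K^~ g);
  pk_add : forall a g h, pnn g -> pnn h -> K a (fun b => g b + h b) = K a g + K a h;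
  pk_scale : forall a (c : R) g, (0 <= c)%R -> pnn g ->
    K a (fun b => c%:E * g b) = c%:E * K a g;
  pk_le : forall a g h, pnn g -> pnn h -> (forall b, g b <= h b) -> K a g <= K a h;
  pk_lim : forall a (g : nat -> path -> \bar R), (forall n, pnn (g n)) ->
    (forall b, {homo (g ^~ b) : n m / (n <= m)%N >-> n <= m}) ->
    K a (fun b => limn (g ^~ b)) = limn (fun n => K a (g n)) }.

Lemma pk_nn K g : pker K -> pnn g -> pnn (K^~ g).
Proof.
move=> kK [mg g0]; split=> [|a]; first exact: (pk_meas kK).
exact: (pk_ge0 kK).
Qed.

Lemma pker_id : pker (fun a g => g a).
Proof. by split=> // g []. Qed.

Lemma pker_comp K L : pker K -> pker L -> pker (fun a g => K a (fun b => L b g)).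
Proof.
move=> kK kL; split.
- by move=> a g g0; apply: (pk_ge0 kK) => b; exact: (pk_ge0 kL).
- by move=> g ng; apply: (pk_meas kK); exact: pk_nn.
- move=> a g h ng nh; rewrite -(pk_add kK); [|exact: pk_nn|exact: pk_nn].
  by congr K; apply/funext => b; rewrite (pk_add kL).
- move=> a c g c0 ng; rewrite -(pk_scale kK)//; last exact: pk_nn.
  by congr K; apply/funext => b; rewrite (pk_scale kL).
- move=> a g h ng nh gh; apply: (pk_le kK); [exact: pk_nn|exact: pk_nn|].
  by move=> b; exact: (pk_le kL).
- move=> a g ng ndg; rewrite -(@pk_lim K kK a (fun n b => L b (g n))).
  + by congr K; apply/funext => b; rewrite (pk_lim kL).
  + by move=> n; exact: pk_nn.
  + by move=> b n m nm; apply: (pk_le kL) => // c; exact: ndg.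
Qed.

Lemma ameas_upd dS (S : measurableType dS) (a : S -> path) (y : S -> 'rV[R]_d) k :
  ameas a -> vmeas y -> ameas (fun s => upd (a s) k (y s)).
Proof. by move=> ma my j; rewrite /upd; case: (j == k). Qed.

Lemma ameas_comp dS (S : measurableType dS) dU (U : measurableType dU) (h : U -> S)
  (a : S -> path) : measurable_fun setT h -> ameas a -> ameas (fun u => a (h u)).
Proof. by move=> mh ma j; exact: (vmeas_comp mh (ma j)). Qed.

Lemma ameas_cst dS (S : measurableType dS) (a : path) : ameas (fun _ : S => a).
Proof. by move=> j; exact: vmeas_cst. Qed.

Lemma pker_dirac (m : path -> 'rV[R]_d) k : pvmeas m ->
  pker (fun a g => g (upd a k (m a))).
Proof.
move=> mm; split=> //.
by move=> g [mg _] dS S a ma; apply: mg; apply: ameas_upd => //; exact: mm.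
Qed.

Lemma pker_density (rho : path -> 'rV[R]_d -> R) k :
  (forall a y, 0 <= rho a y)%R ->
  (forall dS (S : measurableType dS) (a : S -> path) (y : S -> 'rV[R]_d), ameas a -> vmeas y ->
    measurable_fun setT (fun s => rho (a s) (y s))) ->
  pker (fun a g => \int[@lebRd R d]_t ((rho a (rv t))%:E * g (upd a k (rv t)))).
Proof.
move=> r0 mr.
have mI g dS (S : measurableType dS) (a : S -> path) (y : S -> 'rV[R]_d) :
    pmeas g -> ameas a -> vmeas y ->
    measurable_fun setT (fun s => (rho (a s) (y s))%:E * g (upd (a s) k (y s))).
  move=> mg ma my; apply: emeasurable_funM; last by apply: mg; exact: ameas_upd.
  by apply/measurable_EFinP; exact: mr.
have mI1 g a : pmeas g ->
    measurable_fun setT (fun t : d.-tuple R => (rho a (rv t))%:E * g (upd a k (rv t))).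
  by move=> mg; apply: (mI g _ _ (fun=> a)) => //; [exact: ameas_cst|exact: vmeas_rv].
have I0 g a : (forall b, 0 <= g b) ->
    forall t : d.-tuple R, 0 <= (rho a (rv t))%:E * g (upd a k (rv t)).
  by move=> g0 t; rewrite mule_ge0// lee_fin.
split.
- by move=> a g g0; apply: integral_ge0 => t _; exact: I0.
- move=> g [mg g0] dS S a ma.
  apply: (measurable_fun_fubini_tonelli_F (m2 := @lebRd R d) (fun p : S * d.-tuple R =>
    (rho (a p.1) (rv p.2))%:E * g (upd (a p.1) k (rv p.2)))).
    apply: (mI g _ _ (fun p : S * d.-tuple R => a p.1)) => //.
      exact: (ameas_comp measurable_fst).
    exact: (vmeas_rv_comp measurable_snd).
  by move=> p; exact: I0.
- move=> a g h [mg g0] [mh h0]; rewrite -ge0_integralTD.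
  + by apply: eq_integral => t _; rewrite ge0_muleDr.
  + exact: mI1.
  + exact: I0.
  + exact: mI1.
  + exact: I0.
- move=> a c g c0 [mg g0]; rewrite -ge0_integralTZl//.
  + by apply: eq_integral => t _; rewrite muleCA.
  + exact: mI1.
  + exact: I0.
- move=> a g h [mg g0] [mh h0] gh; apply: ge0_le_integralT.
  + exact: mI1.
  + exact: I0.
  + exact: mI1.
  + by move=> t; rewrite lee_wpmul2l// lee_fin.
- move=> a g ng ndg; rewrite -monotone_convergence//.
  + apply: eq_integral => t _; rewrite limeMl//.
    by apply: ereal_nondecreasing_is_cvgn; exact: ndg.
  + by move=> n; apply: mI1; have [] := ng n.
  + by move=> n t _; apply: I0; have [] := ng n.
  + by move=> t _ n m nm; rewrite lee_wpmul2l// ?lee_fin//; exact: ndg.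
Qed.

Lemma pker_gauss (m : path -> 'rV[R]_d) (b : R) k : pvmeas m ->
  pker (fun a g => gauss_int (m a) b (fun y => g (upd a k y))).
Proof.
move=> mm; rewrite /gauss_int; case: (b == 0)%R; first exact: pker_dirac.
apply: (@pker_density (fun a y => gauss_pdf (m a) b y)) => [a y|dS S a y ma my].
  exact: gauss_pdf_ge0.
by apply: measurable_gauss_pdf => //; exact: mm.
Qed.

Lemma pvmeas_coord (f : 'rV[R]_d -> 'rV[R]_d) j : rmeas_vec f -> pvmeas (fun a => f (a j)).
Proof.
move=> mf dS S a ma.
have vf : vmeas (fun t => f (@rv R d t)) by apply/measurable_rvP.
rewrite (_ : (fun s => _) = fun s => f (rv (tuple_of_rv (a s j)))).
  exact: (vmeas_comp (vmeas_tuple (ma j)) vf).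
by apply/funext => s; rewrite tuple_of_rvK.
Qed.

Lemma pker_rev (mu : nat -> 'rV[R]_d -> 'rV[R]_d) (s2 : nat -> R) n :
  (forall k, (1 <= k <= n)%N -> rmeas_vec (mu k)) -> pker (rev_chain mu s2 n).
Proof.
elim: n => [|n IH] mmu; first exact: pker_id.
apply: (pker_comp (K := fun a g => gauss_int (mu n.+1 (a n.+1)) (s2 n.+1) (fun y => g (upd a n y)))).
  by apply: pker_gauss; apply: pvmeas_coord; apply: mmu; rewrite /= leqnn.
by apply: IH => k /andP[k1 kn]; apply: mmu; rewrite k1 leqW.
Qed.

Lemma pvmeas_mu_tilde (beta lam : nat -> R) n :
  pvmeas (fun a => mu_tilde beta lam n (a n) (a 0%N)).
Proof.
move=> dS S a ma; apply: vmeasD; first exact: vmeasZ.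
by apply: vmeasZ; apply: vmeasB => //; exact: vmeasZ.
Qed.

Lemma pker_fwd (beta lam : nat -> R) n : pker (fwd_chain beta lam n).
Proof.
elim: n => [|[|n] IH]; [exact: pker_id|exact: pker_id|].
apply: (@pker_comp (fun a g => gauss_int (mu_tilde beta lam n.+2 (a n.+2) (a 0%N))
  (lam n.+2 ^+ 2) (fun y => g (upd a n.+1 y))) (fwd_chain beta lam n.+1) _ IH).
by apply: pker_gauss; exact: pvmeas_mu_tilde.
Qed.

Lemma gauss_int_eq (m : 'rV[R]_d) (b : R) (g h : 'rV[R]_d -> \bar R) : g =1 h ->
  gauss_int m b g = gauss_int m b h.
Proof. by move=> /funext ->. Qed.

Lemma gauss_int_cst (m : 'rV[R]_d) (b : R) (c : \bar R) : (0 <= b)%R -> 0 <= c ->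
  gauss_int m b (fun=> c) = c.
Proof.
move=> b0 c0; rewrite /gauss_int; have [//|bn0] := eqVneq b 0%R.
rewrite ge0_integralZr//.
- by rewrite integral_gauss_pdf ?mul1e// lt_neqAle eq_sym bn0.
- by apply/measurable_EFinP; exact: measurable_gauss_pdf_rv.
- by move=> t _; rewrite lee_fin gauss_pdf_ge0.
Qed.

(** The chain overwrites only the entries below [n], so along it every factor in the later entries
    is a constant. The forward chain moreover never overwrites entry 0. *)
Lemma rev_chain_local (mu : nat -> 'rV[R]_d -> 'rV[R]_d) (s2 : nat -> R) n acc g h :
  (forall a : path, (forall i, (n <= i)%N -> a i = acc i) -> g a = h a) ->
  rev_chain mu s2 n acc g = rev_chain mu s2 n acc h.
Proof.
elim: n acc => [|n IH] acc gh /=; first exact: gh.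
apply: gauss_int_eq => y; apply: IH => a aE; apply: gh => i ni.
by rewrite aE ?(ltnW ni)// /upd gtn_eqF.
Qed.

Lemma fwd_chain_local (beta lam : nat -> R) n acc g h : (0 < n)%N ->
  (forall a : path, a 0%N = acc 0%N -> (forall i, (n <= i)%N -> a i = acc i) -> g a = h a) ->
  fwd_chain beta lam n acc g = fwd_chain beta lam n acc h.
Proof.
elim: n acc => [//|[|n] IH] acc _ gh /=; first exact: gh.
apply: gauss_int_eq => y; apply: IH => // a a0 aE; apply: gh => [|i ni].
  by rewrite a0.
by rewrite aE ?(ltnW ni)// /upd gtn_eqF.
Qed.

Lemma fwd_chainSS (beta lam : nat -> R) n (acc : path) g :
  fwd_chain beta lam n.+2 acc g =
  gauss_int (mu_tilde beta lam n.+2 (acc n.+2) (acc 0%N)) (lam n.+2 ^+ 2)%R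
    (fun y => fwd_chain beta lam n.+1 (upd acc n.+1 y) g).
Proof. by []. Qed.

Lemma fwd_chainS (beta lam : nat -> R) n (acc : path) g : (0 < n)%N ->
  fwd_chain beta lam n.+1 acc g =
  gauss_int (mu_tilde beta lam n.+1 (acc n.+1) (acc 0%N)) (lam n.+1 ^+ 2)%R
    (fun y => fwd_chain beta lam n (upd acc n y) g).
Proof. by case: n. Qed.

Lemma rev_chainS (mu : nat -> 'rV[R]_d -> 'rV[R]_d) (s2 : nat -> R) n (acc : path) g :
  rev_chain mu s2 n.+1 acc g =
  gauss_int (mu n.+1 (acc n.+1)) (s2 n.+1) (fun y => rev_chain mu s2 n (upd acc n y) g).
Proof. by []. Qed.

Lemma fwd_chain_cst (beta lam : nat -> R) n (acc : path) (c : \bar R) : 0 <= c ->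
  fwd_chain beta lam n acc (fun=> c) = c.
Proof.
move=> c0; elim: n acc => [//|[//|n] IH] acc.
rewrite -[RHS](gauss_int_cst (mu_tilde beta lam n.+2 (acc n.+2) (acc 0%N)) (sqr_ge0 (lam n.+2)) c0).
by apply: gauss_int_eq => y; exact: IH.
Qed.

(** Starting entries strictly between 0 and [n] are overwritten before being read, and [g] ignores
    those above [M]; hence the two starts may differ there. *)
Lemma fwd_chain_start (beta lam : nat -> R) n M acc acc' g : (0 < n <= M)%N ->
  acc 0%N = acc' 0%N -> (forall i, (n <= i <= M)%N -> acc i = acc' i) ->
  (forall a a' : path, (forall i, (i <= M)%N -> a i = a' i) -> g a = g a') ->
  fwd_chain beta lam n acc g = fwd_chain beta lam n acc' g.
Proof.
move=> /andP[n0 nM]; elim: n acc acc' n0 nM => [//|[|n] IH] acc acc' _ nM e0 eM eg.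
  by apply: eg => -[|i] iM; [exact: e0|exact: eM].
have e2 : acc n.+2 = acc' n.+2 by apply: eM; rewrite leqnn.
rewrite 2!fwd_chainSS e0 e2; apply: gauss_int_eq => y.
apply: IH; [by []|exact: ltnW|exact: e0| |exact: eg].
move=> i /andP[ni iM]; rewrite /upd; case: eqP => // /eqP nei.
by apply: eM; rewrite iM andbT ltn_neqAle eq_sym nei.
Qed.

(** Density of the chain with [mu], [s2] relative to the one with [mu'], [s2']; the initial law N(0,
    I) is common to both and cancels. *)
Definition dratio (mu mu' : nat -> 'rV[R]_d -> 'rV[R]_d) (s2 s2' : nat -> R) n (a : path) : R :=
  (\prod_(k < n) (gauss_pdf (mu k.+1 (a k.+1)) (s2 k.+1) (a k) /
                  gauss_pdf (mu' k.+1 (a k.+1)) (s2' k.+1) (a k)))%R.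

Lemma dratioS mu mu' (s2 s2' : nat -> R) n a :
  dratio mu mu' s2 s2' n.+1 a = (dratio mu mu' s2 s2' n a *
    (gauss_pdf (mu n.+1 (a n.+1)) (s2 n.+1) (a n) /
     gauss_pdf (mu' n.+1 (a n.+1)) (s2' n.+1) (a n)))%R.
Proof. by rewrite /dratio big_ord_recr. Qed.

Lemma dratio_ge0 mu mu' s2 s2' n a : (0 <= dratio mu mu' s2 s2' n a)%R.
Proof. by apply: prodr_ge0 => k _; rewrite divr_ge0 ?gauss_pdf_ge0. Qed.

Lemma dratio_gt0 mu mu' (s2 s2' : nat -> R) n a :
  (forall k, (1 <= k <= n)%N -> 0 < s2 k)%R -> (forall k, (1 <= k <= n)%N -> 0 < s2' k)%R ->
  (0 < dratio mu mu' s2 s2' n a)%R.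
Proof.
move=> s0 s0'; apply: prodr_gt0 => k _; rewrite divr_gt0// gauss_pdf_gt0//.
  by apply: s0; rewrite /= ltn_ord.
by apply: s0'; rewrite /= ltn_ord.
Qed.

Lemma measurable_dratio mu mu' (s2 s2' : nat -> R) n dS (S : measurableType dS) (a : S -> path) :
  (forall k, (1 <= k <= n)%N -> rmeas_vec (mu k)) ->
  (forall k, (1 <= k <= n)%N -> rmeas_vec (mu' k)) ->
  (forall k, (1 <= k <= n)%N -> 0 < s2' k)%R ->
  ameas a -> measurable_fun setT (fun s => dratio mu mu' s2 s2' n (a s)).
Proof.
move=> mmu mmu' s0' ma; apply: measurable_prod => k _.
have kn : (1 <= k.+1 <= n)%N by rewrite /= ltn_ord.
apply: measurable_funM.
  by apply: measurable_gauss_pdf => //; exact: (pvmeas_coord _ (mmu _ kn)).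
apply: measurable_funV_gt0 => [|x]; last by rewrite gauss_pdf_gt0// s0'.
by apply: measurable_gauss_pdf => //; exact: (pvmeas_coord _ (mmu' _ kn)).
Qed.

(** Change of law one step at a time: the last factor involves only the entries [n] and [n.+1],
    which the rest of the chain leaves fixed. It therefore comes out of the inner chain, where it
    replaces one Gaussian density by the other. *)
Lemma rev_chain_dratio mu mu' (s2 s2' : nat -> R) n acc g :
  (forall k, (1 <= k <= n)%N -> rmeas_vec (mu k)) ->
  (forall k, (1 <= k <= n)%N -> rmeas_vec (mu' k)) ->
  (forall k, (1 <= k <= n)%N -> 0 < s2 k)%R -> (forall k, (1 <= k <= n)%N -> 0 < s2' k)%R ->
  pnn g ->
  rev_chain mu s2 n acc g =
  rev_chain mu' s2' n acc (fun a => (dratio mu mu' s2 s2' n a)%:E * g a).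
Proof.
move=> mmu mmu' s0 s0' [mg g0]; elim: n mmu mmu' s0 s0' acc => [|n IH] mmu mmu' s0 s0' acc.
  by rewrite /= /dratio big_ord0 mul1e.
have sub (P : nat -> Prop) : (forall k, (1 <= k <= n.+1)%N -> P k) ->
    forall k, (1 <= k <= n)%N -> P k.
  by move=> Pk k /andP[k1 kn]; apply: Pk; rewrite k1 leqW.
have sn : (0 < s2 n.+1)%R by apply: s0; rewrite /= leqnn.
have sn' : (0 < s2' n.+1)%R by apply: s0'; rewrite /= leqnn.
rewrite 2!rev_chainS /gauss_int (gt_eqF sn) (gt_eqF sn'); apply: eq_integral => t _.
rewrite (IH (sub _ mmu) (sub _ mmu') (sub _ s0) (sub _ s0')).
set y := rv t; set p := gauss_pdf _ _ _; set p' := gauss_pdf _ _ _.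
rewrite (@rev_chain_local mu' s2' n (upd acc n y)
  (fun a => (dratio mu mu' s2 s2' n.+1 a)%:E * g a)
  (fun a => (p / p')%:E * ((dratio mu mu' s2 s2' n a)%:E * g a))); last first.
  move=> a aE; rewrite muleA -EFinM; congr (_%:E * _)%E.
  have an : a n = y by rewrite (aE n (leqnn n)) /upd eqxx.
  have aS : a n.+1 = acc n.+1 by rewrite (aE n.+1 (leqnSn n)) /upd gtn_eqF.
  by rewrite dratioS an aS mulrC.
rewrite (pk_scale (pker_rev s2' (sub _ mmu'))).
- by rewrite muleA -EFinM mulrC divfK// gt_eqF// gauss_pdf_gt0.
- by rewrite divr_ge0 ?gauss_pdf_ge0.
- split=> [|a]; last by rewrite mule_ge0// lee_fin dratio_ge0.
  move=> dS S a ma; apply: emeasurable_funM; last exact: mg.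
  by apply/measurable_EFinP; apply: measurable_dratio => //; exact: sub.
Qed.

(** * Expectations of functions of the whole trajectory *)

Section joint.
Variable N : nat.
Notation T := (N.+1.-tuple (d.-tuple R)).

(** Entries beyond [N] get the default value zero; the functionals later composed with [path_of]
    read only the entries 0 to [N]. *)
Definition path_of (X : T) : path := fun i => rv (nth (tuple_of_rv 0) X i).

Lemma path_of_joint (a : path) i : (i <= N)%N -> path_of (joint_of N a) i = a i.
Proof.
move=> iN; rewrite /path_of /joint_of.
have -> : nth (tuple_of_rv 0) [tuple tuple_of_rv (a (val j)) | j < N.+1] i =
    tnth [tuple tuple_of_rv (a (val j)) | j < N.+1] (Ordinal (iN : (i < N.+1)%N)).
  by rewrite (tnth_nth (tuple_of_rv 0)).
by rewrite tnth_mktuple tuple_of_rvK.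
Qed.

Lemma measurable_joint_of dS (S : measurableType dS) (a : S -> path) : ameas a ->
  measurable_fun setT (fun s => joint_of N (a s)).
Proof.
move=> ma; apply/measurable_fun_tnthP => i.
rewrite (_ : _ \o _ = fun s => tuple_of_rv (a s i)); first exact/vmeas_tuple/ma.
by apply/funext => s /=; rewrite tnth_mktuple.
Qed.

Lemma ameas_path_of : ameas (fun X : T => path_of X).
Proof.
move=> i; apply: vmeas_rv_comp.
have [iN|Ni] := ltnP i N.+1.
  rewrite (_ : (fun X => _) = fun X : T => tnth X (Ordinal iN)); first exact: measurable_tnth.
  by apply/funext => X; rewrite (tnth_nth (tuple_of_rv 0)).
rewrite (_ : (fun X => _) = cst (tuple_of_rv 0)); first exact: measurable_cst.
by apply/funext => X; rewrite nth_default// size_tuple.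
Qed.

Lemma pnn_joint (f : T -> \bar R) : nnm f -> pnn (fun a => f (joint_of N a)).
Proof.
move=> [mf f0]; split=> // dS S a ma.
exact: (measurableT_comp mf (measurable_joint_of ma)).
Qed.

Lemma pker_daniell K a : pker K -> daniell (fun f : T -> \bar R => K a (fun b => f (joint_of N b))).
Proof.
move=> kK; split.
- by move=> f f0; exact: (pk_ge0 kK).
- by move=> f g nf ng; apply: (pk_add kK); exact: pnn_joint.
- by move=> c f c0 nf; apply: (pk_scale kK) => //; exact: pnn_joint.
- by move=> f g nf ng fg; apply: (pk_le kK) => //; exact: pnn_joint.
- by move=> g ng ndg; apply: (@pk_lim K kK a (fun n b => g n (joint_of N b))) => // n; exact: pnn_joint.
Qed.

Definition rev_exp mu (s2 : nat -> R) (g : path -> \bar R) : \bar R :=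
  gauss_int 0 1 (fun xN => rev_chain mu s2 N (upd (fun=> 0%R) N xN) g).

Definition fwd_exp (beta lam : nat -> R) (q0 : 'rV[R]_d -> R) (g : path -> \bar R) : \bar R :=
  \int[@lebRd R d]_t ((q0 (rv t))%:E *
     gauss_int (Num.sqrt (abar beta N) *: rv t) (bbar beta N)
       (fun xN => fwd_chain beta lam N (upd (upd (fun=> 0%R) 0 (rv t)) N xN) g)).

Lemma pvmeas_scale (c : R) j : pvmeas (fun a => c *: a j).
Proof. by move=> dS S a ma; exact: vmeasZ. Qed.

Lemma pvmeas_cst (v : 'rV[R]_d) : pvmeas (fun _ : path => v).
Proof. by move=> dS S a ma; exact: vmeas_cst. Qed.

Lemma rev_exp_ker mu (s2 : nat -> R) :
  (forall k, (1 <= k <= N)%N -> rmeas_vec (mu k)) ->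
  exists2 K, pker K & forall g, rev_exp mu s2 g = K (fun=> 0%R) g.
Proof.
move=> mmu.
exists (fun a g => gauss_int 0 1 (fun xN => rev_chain mu s2 N (upd a N xN) g)) => //.
apply: (@pker_comp (fun a g => gauss_int 0 1 (fun y => g (upd a N y))) (rev_chain mu s2 N)).
  by apply: pker_gauss; exact: pvmeas_cst.
exact: pker_rev.
Qed.

Lemma rmeas_real_comp (q0 : 'rV[R]_d -> R) dS (S : measurableType dS) (y : S -> 'rV[R]_d) :
  rmeas_real q0 -> vmeas y -> measurable_fun setT (fun s => q0 (y s)).
Proof.
move=> mq my; rewrite (_ : (fun s => _) = (fun t => q0 (rv t)) \o (fun s => tuple_of_rv (y s))).
  exact: measurableT_comp mq (vmeas_tuple my).
by apply/funext => s /=; rewrite tuple_of_rvK.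
Qed.

Lemma fwd_exp_ker (beta lam : nat -> R) q0 : rmeas_real q0 -> (forall x, 0 <= q0 x)%R ->
  (0 < N)%N ->
  exists2 K, pker K & forall g, fwd_exp beta lam q0 g = K (fun=> 0%R) g.
Proof.
move=> mq q00 N0.
pose L (a : path) (g : path -> \bar R) := gauss_int (Num.sqrt (abar beta N) *: a 0%N) (bbar beta N)
  (fun xN => fwd_chain beta lam N (upd a N xN) g).
have kL : pker L.
  apply: (@pker_comp (fun a g => gauss_int (Num.sqrt (abar beta N) *: a 0%N) (bbar beta N)
    (fun y => g (upd a N y))) (fwd_chain beta lam N)); last exact: pker_fwd.
  by apply: pker_gauss; exact: pvmeas_scale.
exists (fun a g => \int[@lebRd R d]_t ((q0 (rv t))%:E * L (upd a 0 (rv t)) g));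
  last by [].
apply: (@pker_comp (fun a g => \int[@lebRd R d]_t ((q0 (rv t))%:E * g (upd a 0 (rv t)))) L _ kL).
apply: (@pker_density (fun _ y => q0 y)) => // dS S a y ma my.
exact: rmeas_real_comp.
Qed.

End joint.

(** * Pair marginals of the forward chain given x_0 *)

Section marginals.
Variables (beta lam : nat -> R) (N : nat).
Hypothesis beta01 : forall n, (1 <= n <= N)%N -> (0 < beta n < 1)%R.
Hypothesis lamP : forall n, (1 <= n <= N)%N -> (0 <= lam n)%R /\ (lam n ^+ 2 <= bbar beta n.-1)%R.

Lemma abarS n : abar beta n.+1 = (abar beta n * (1 - beta n.+1))%R.
Proof. by rewrite /abar big_nat_recr. Qed.

Lemma abar0 : abar beta 0 = 1%R.
Proof. by rewrite /abar big_geq. Qed.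

Lemma bbar0 : bbar beta 0 = 0%R.
Proof. by rewrite /bbar abar0 subrr. Qed.

Lemma abar_gt0 n : (n <= N)%N -> (0 < abar beta n)%R.
Proof.
elim: n => [|n IH] nN; first by rewrite abar0.
rewrite abarS mulr_gt0 ?IH ?(ltnW nN)// subr_gt0.
by have /andP[] := beta01 (n := n.+1) nN.
Qed.

Lemma abar_le1 n : (n <= N)%N -> (abar beta n <= 1)%R.
Proof.
elim: n => [|n IH] nN; first by rewrite abar0.
have /andP[b0 b1] := beta01 (n := n.+1) nN.
rewrite abarS mulr_ile1 ?IH ?(ltnW nN)//; last by rewrite gerBl ltW.
  by rewrite ltW// abar_gt0// ltnW.
by rewrite subr_ge0 ltW.
Qed.

Lemma bbar_gt0 n : (1 <= n <= N)%N -> (0 < bbar beta n)%R.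
Proof.
case: n => // n nN; rewrite /bbar subr_gt0.
have /andP[b0 b1] := beta01 nN.
rewrite abarS; apply: (@le_lt_trans _ _ (1 - beta n.+1)%R); last by rewrite ltrBlDr ltrDl.
by rewrite ler_piMl ?abar_le1 ?(ltnW nN)// subr_ge0 ltW.
Qed.

Lemma lam1_eq0 : (0 < N)%N -> (lam 1 ^+ 2 = 0)%R.
Proof.
move=> N0; have [_] := lamP (n := 1) N0; rewrite /= bbar0 => h.
by apply/eqP; rewrite eq_le h sqr_ge0.
Qed.

(** [fwd_chain] stops at x_1 and draws no step towards x_0. As the constraint forces lambda_1 = 0,
    such a step would be the Dirac mass at x_0, so [fwd_exp_pair] also covers [n = 1]. *)
Lemma mu_tilde1 (x t : 'rV[R]_d) : (0 < N)%N -> mu_tilde beta lam 1 x t = t.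
Proof.
move=> N0; rewrite /mu_tilde /= abar0 sqrtr1 scale1r bbar0 lam1_eq0// subr0 sqrtr0.
by rewrite mul0r scale0r addr0.
Qed.

(** Integrating out x_(M+1) gives x_M its own Gaussian law given x_0. The coefficient [c] of x_(M+1)
    in [mu_tilde] is such that the variances add up to [bbar beta M], which is [c2]. *)
Lemma gauss_int_fwd_step (acc : path) M (h : path -> \bar R) n :
  (0 < n <= M)%N -> (M < N)%N -> pnn h ->
  (forall a a' : path, (forall i, (i <= n)%N -> a i = a' i) -> h a = h a') ->
  gauss_int (Num.sqrt (abar beta M.+1) *: acc 0%N) (bbar beta M.+1)
    (fun x => fwd_chain beta lam M.+1 (upd acc M.+1 x) h) =
  gauss_int (Num.sqrt (abar beta M) *: acc 0%N) (bbar beta M)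
    (fun y => fwd_chain beta lam M (upd acc M y) h).
Proof.
move=> /andP[n0 nM] MN nh hloc.
have M0 : (0 < M)%N by exact: leq_trans nM.
have bM1 : (0 < bbar beta M.+1)%R by apply: bbar_gt0.
have bM : (0 < bbar beta M)%R by apply: bbar_gt0; rewrite M0 ltnW.
have [l0 lM] := lamP (n := M.+1) MN.
pose c := (Num.sqrt (bbar beta M - lam M.+1 ^+ 2) / Num.sqrt (bbar beta M.+1))%R.
have c2 : (c ^+ 2 * bbar beta M.+1 + lam M.+1 ^+ 2 = bbar beta M)%R.
  rewrite /c expr_div_n (sqr_sqrtr (ltW bM1)) sqr_sqrtr; last by rewrite subr_ge0.
  by rewrite divfK ?gt_eqF// subrK.
rewrite -[in RHS]c2 -(@gauss_int_conv R d (Num.sqrt (abar beta M.+1) *: acc 0%N)).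
- congr gauss_int; apply/funext => x.
  rewrite (fwd_chainS beta lam _ _ M0).
  have -> : upd acc M.+1 x M.+1 = x by rewrite /upd eqxx.
  have -> : upd acc M.+1 x 0%N = acc 0%N by [].
  rewrite /mu_tilde -/c; apply: gauss_int_eq => y.
  apply: (@fwd_chain_start _ _ M M); [by rewrite M0 leqnn| | |].
  - by rewrite /upd; case: (0%N == M).
  - by move=> i /andP[iM Mi]; rewrite /upd; case: eqP => // _; rewrite ltn_eqF.
  - by move=> a a' aa'; apply: hloc => i ni; apply: aa'; exact: leq_trans nM.
- exact: bM1.
- by rewrite divr_ge0 ?sqrtr_ge0.
- exact: sqr_ge0.
- by rewrite c2.
- apply: (pk_meas (pker_fwd beta lam M) nh); apply: ameas_upd; last exact: vmeas_rv.
  exact: ameas_cst.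
- by move=> x; apply: (pk_ge0 (pker_fwd beta lam M)); have [] := nh.
Qed.

Lemma gauss_int_fwd (acc : path) M n (h : path -> \bar R) :
  (0 < n <= M)%N -> (M <= N)%N -> pnn h ->
  (forall a a' : path, (forall i, (i <= n)%N -> a i = a' i) -> h a = h a') ->
  gauss_int (Num.sqrt (abar beta M) *: acc 0%N) (bbar beta M)
    (fun x => fwd_chain beta lam M (upd acc M x) h) =
  gauss_int (Num.sqrt (abar beta n) *: acc 0%N) (bbar beta n)
    (fun y => fwd_chain beta lam n (upd acc n y) h).
Proof.
move=> /andP[n0 nM] MN nh hloc; elim: M nM MN => [|M IH] nM MN.
  by case: n n0 nM {hloc}.
move: nM; rewrite leq_eqVlt => /predU1P[-> //|nM].
rewrite (@gauss_int_fwd_step acc M h n)// ?n0//.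
by apply: IH; rewrite // ltnW.
Qed.

Lemma fwd_exp_pair q0 n (H : 'rV[R]_d -> 'rV[R]_d -> \bar R) :
  (1 <= n <= N)%N -> pnn (fun a => H (a n.-1) (a n)) ->
  fwd_exp N beta lam q0 (fun a => H (a n.-1) (a n)) =
  \int[@lebRd R d]_t ((q0 (rv t))%:E *
    gauss_int (Num.sqrt (abar beta n) *: rv t) (bbar beta n)
      (fun x => gauss_int (mu_tilde beta lam n x (rv t)) (lam n ^+ 2)%R (fun y => H y x))).
Proof.
move=> /andP[n0 nN] nH; have N0 : (0 < N)%N by exact: leq_trans nN.
apply: eq_integral => t _; congr (_ * _).
rewrite (@gauss_int_fwd (upd (fun=> 0%R) 0 (rv t)) N n)//; last 2 first.
- by rewrite n0.
- by move=> a a' aa'; rewrite !aa'// leq_pred.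
apply: gauss_int_eq => x; case: n n0 nN nH => // -[|n] n0 nN nH.
  by rewrite mu_tilde1// lam1_eq0// /gauss_int eqxx.
rewrite fwd_chainSS; have -> : upd (upd (fun=> 0%R) 0 (rv t)) n.+2 x n.+2 = x.
  by rewrite /upd eqxx.
apply: gauss_int_eq => y.
rewrite (@fwd_chain_local _ _ _ _ _ (fun=> H y x))//.
  (* [fwd_chain_cst] needs [H y x] nonnegative; this is read off [nH] at a path with entry [y] at
     [n.+1] and [x] elsewhere. *)
  by rewrite fwd_chain_cst//; have [_ /(_ (fun i => if i == n.+1 then y else x))] := nH;
     rewrite /= eqxx gtn_eqF.
by move=> a _ aE; rewrite /= !aE// /upd !eqxx gtn_eqF.
Qed.

End marginals.

End Pker.

Lemma lebRd_set1_gt0 (R : realType) k (t : k.-tuple R) : (0 < k)%N ->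
  @lebRd R k [set t] = 0%E.
Proof. by case: k t => // k t _; exact: lebRd_set1. Qed.

(** * Tweedie's formula *)

Section Score.
Context {R : realType} {d : nat}.
Variables (q0 : 'rV[R]_d -> R) (a b : R).
Hypothesis b_gt0 : 0 < b.
Hypothesis q0P : is_density_2mom q0.

Let mu := @lebRd R d.
Local Notation tup := (d.-tuple R).

(** Joint density of (x_0, x_n), that is, the unnormalised posterior of x_0 given x_n = x, when [a]
    is the root of abar_n and [b] is bbar_n. Its integral [mix] is then the marginal density
    [marg]. *)
Definition post (x : 'rV[R]_d) (t : tup) : R := q0 (rv t) * gauss_pdf (a *: rv t) b x.
Definition mix (x : 'rV[R]_d) : R := fine (\int[@lebRd R d]_t (post x t)%:E)%E.
Definition mix_score (x : 'rV[R]_d) : 'rV[R]_d :=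
  \row_i ('D_(delta_mx 0 i) (fun y => ln (mix y)) x).

Definition gmax : R := (Num.sqrt (2 * pi * b) ^+ d)^-1.

Lemma gmax_ge0 : 0 <= gmax.
Proof. by rewrite invr_ge0 exprn_ge0// sqrtr_ge0. Qed.

Lemma gauss_pdf_le (m x : 'rV[R]_d) : gauss_pdf m b x <= gmax.
Proof.
rewrite /gauss_pdf -[leRHS]mulr1 ler_wpM2l ?gmax_ge0//.
rewrite -expR0 ler_expR mulNr oppr_le0 divr_ge0 ?sqnorm_ge0// mulr_ge0// ltW//.
Qed.

Lemma q0_ge0 x : 0 <= q0 x. Proof. by case: q0P. Qed.

Lemma measurable_q0 : measurable_fun setT (fun t : tup => q0 (rv t)).
Proof. by case: q0P. Qed.

Lemma post_ge0 x t : 0 <= post x t.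
Proof. by rewrite mulr_ge0 ?q0_ge0 ?gauss_pdf_ge0. Qed.

Lemma post_le x t : post x t <= gmax * q0 (rv t).
Proof. by rewrite /post mulrC ler_wpM2r ?q0_ge0 ?gauss_pdf_le. Qed.

Lemma measurable_post_pair dS (S : measurableType dS) (x : S -> 'rV[R]_d) (t : S -> tup) :
  vmeas x -> measurable_fun setT t -> measurable_fun setT (fun s => post (x s) (t s)).
Proof.
move=> mx mt; apply: measurable_funM; first exact: measurableT_comp measurable_q0 mt.
by apply: measurable_gauss_pdf => //; apply: vmeasZ; exact: vmeas_rv_comp.
Qed.

Lemma measurable_post x : measurable_fun setT (post x).
Proof. by apply: measurable_post_pair => //; exact: vmeas_cst. Qed.

Lemma integrable_q0 : mu.-integrable setT (fun t : tup => (q0 (rv t))%:E).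
Proof.
apply/integrableP; split; first by apply/measurable_EFinP; exact: measurable_q0.
under eq_integral do rewrite gee0_abs ?lee_fin ?q0_ge0//.
by case: q0P => _ _ -> _; rewrite ltry.
Qed.

Lemma integrable_q0_sqnorm :
  mu.-integrable setT (fun t : tup => (q0 (rv t) * sqnorm (rv t))%:E).
Proof.
apply/integrableP; split.
  apply/measurable_EFinP; apply: measurable_funM; first exact: measurable_q0.
  by apply: measurable_sqnorm; exact: vmeas_rv.
under eq_integral do rewrite gee0_abs ?lee_fin ?mulr_ge0 ?q0_ge0 ?sqnorm_ge0//.
by case: q0P.
Qed.

(** The Gaussian factor is at most its peak value [gmax], so the second moment of [q0] makes every
    function of at most quadratic growth integrable against [post x]. *)
Lemma integrable_post_le x (f : tup -> R) (A B : R) : measurable_fun setT f ->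
  0 <= A -> 0 <= B -> (forall t, `|f t| <= A + B * sqnorm (rv t)) ->
  mu.-integrable setT (fun t => (post x t * f t)%:E).
Proof.
move=> mf A0 B0 fle.
have iG : mu.-integrable setT (fun t : tup =>
    (gmax * A)%:E * (q0 (rv t))%:E + (gmax * B)%:E * (q0 (rv t) * sqnorm (rv t))%:E)%E.
  apply: integrableD => //; apply: integrableZl => //.
    exact: integrable_q0.
  exact: integrable_q0_sqnorm.
apply: le_integrable iG => //.
  by apply/measurable_EFinP; apply: measurable_funM => //; exact: measurable_post.
move=> t _; rewrite -!EFinM -EFinD /= lee_fin normrM (ger0_norm (post_ge0 x t)).
apply: le_trans (ler_norm _).
apply: (@le_trans _ _ (gmax * q0 (rv t) * (A + B * sqnorm (rv t)))); last first.
  by rewrite le_eqVlt; apply/orP; left; apply/eqP; ring.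
by rewrite ler_pM// ?post_ge0// post_le.
Qed.

Lemma sqnormB_le (u v : 'rV[R]_d) : sqnorm (u - v) <= 2 * sqnorm u + 2 * sqnorm v.
Proof.
rewrite /sqnorm !mulr_sumr -big_split /=; apply: ler_sum => i _; rewrite !mxE.
rewrite -subr_ge0 (_ : _ - _ = (u 0 i + v 0 i) ^+ 2) ?sqr_ge0//.
by move: (u 0 i) (v 0 i) => y z; ring.
Qed.

Lemma coord_le_sqnorm (u : 'rV[R]_d) i : `|u 0 i| <= 1 + sqnorm u.
Proof.
have h : u 0 i ^+ 2 <= sqnorm u.
  by rewrite /sqnorm (bigD1 i)//= lerDl sumr_ge0// => j _; exact: sqr_ge0.
move: h; rewrite -(real_normK (num_real (u 0 i))).
have := normr_ge0 (u 0 i); move: `|u 0 i| (sqnorm u) => z S z0 h.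
have : 0 <= (z - 1) ^+ 2 by exact: sqr_ge0.
nra.
Qed.

Lemma integrable_post x : mu.-integrable setT (fun t => (post x t)%:E).
Proof.
rewrite (_ : (fun t => _) = fun t => (post x t * cst 1 t)%:E); last first.
  by apply/funext => t; rewrite mulr1.
apply: (@integrable_post_le _ _ 1 0) => // t.
by rewrite /= normr1 mul0r addr0.
Qed.

Lemma vmeas_shift (v : 'rV[R]_d) : vmeas (fun t : tup => a *: rv t - v).
Proof. by apply: vmeasB; [apply: vmeasZ; exact: vmeas_rv|exact: vmeas_cst]. Qed.

Lemma integrable_post_sqnorm x v :
  mu.-integrable setT (fun t => (post x t * sqnorm (a *: rv t - v))%:E).
Proof.
apply: (@integrable_post_le _ _ (2 * sqnorm v) (2 * a ^+ 2)).
- by apply: measurable_sqnorm; exact: vmeas_shift.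
- by rewrite mulr_ge0// sqnorm_ge0.
- by rewrite mulr_ge0// sqr_ge0.
- move=> t; rewrite ger0_norm ?sqnorm_ge0//; apply: le_trans (sqnormB_le _ _) _.
  by rewrite sqnormZ mulrA addrC.
Qed.

Lemma integrable_post_coord x v i :
  mu.-integrable setT (fun t => (post x t * (a *: rv t - v) 0 i)%:E).
Proof.
apply: (@integrable_post_le _ _ (1 + 2 * sqnorm v) (2 * a ^+ 2)).
- exact: vmeas_shift.
- by rewrite addr_ge0// mulr_ge0// sqnorm_ge0.
- by rewrite mulr_ge0// sqr_ge0.
- move=> t; apply: le_trans (coord_le_sqnorm _ _) _; rewrite -addrA lerD2l.
  apply: le_trans (sqnormB_le _ _) _.
  by rewrite sqnormZ mulrA addrC.
Qed.

Lemma mix_EFin x : (mix x)%:E = (\int[mu]_t (post x t)%:E)%E.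
Proof. by rewrite /mix fineK//; apply: integrable_fin_num => //; exact: integrable_post. Qed.

Lemma q0_not_ae0 : ~ {ae mu, forall t, setT t -> (q0 (rv t))%:E = 0%E}.
Proof.
move=> q00; have := @ge0_ae_eq_integral _ _ _ mu setT (fun t : tup => (q0 (rv t))%:E) (cst 0%E).
rewrite integral0; have [_ _ -> _] := q0P => /(_ measurableT) h.
have : (1 = 0 :> \bar R)%E.
  apply: h => //; first by apply/measurable_EFinP; exact: measurable_q0.
  by move=> t _; rewrite lee_fin q0_ge0.
by move/eqP; rewrite eqe oner_eq0.
Qed.

Lemma mix_gt0 x : 0 < mix x.
Proof.
rewrite lt_neqAle; apply/andP; split; last first.
  by rewrite -lee_fin mix_EFin; apply: integral_ge0 => t _; rewrite lee_fin post_ge0.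
apply/negP => /eqP x0; apply: q0_not_ae0.
have : (\int[mu]_t `|(post x t)%:E| = 0)%E.
  under eq_integral do rewrite gee0_abs ?lee_fin ?post_ge0//.
  by rewrite -mix_EFin -x0.
move/ae_eq_integral_abs => /(_ measurableT) H.
have mp : measurable_fun setT (fun t => (post x t)%:E).
  by apply/measurable_EFinP; exact: measurable_post.
move: (H mp); apply: filterS => t /(_ I) [] /eqP; rewrite mulf_eq0 => /orP[/eqP -> //|].
by rewrite gt_eqF// gauss_pdf_gt0.
Qed.

Lemma sqnorm_line (u : 'rV[R]_d) i h :
  sqnorm (h *: delta_mx 0 i + u) = sqnorm u + 2 * h * u 0 i + h ^+ 2.
Proof.
rewrite /sqnorm (bigD1 i)//= [in RHS](bigD1 i)//= !mxE !eqxx /= mulr1.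
rewrite (eq_bigr (fun j => u 0 j ^+ 2)).
  by ring.
by move=> j ji; rewrite !mxE eqxx /= (negbTE ji) mulr0 add0r.
Qed.

Lemma gauss_pdf_line (m x : 'rV[R]_d) i h :
  gauss_pdf m b (h *: delta_mx 0 i + x) =
  gmax * expR (- (sqnorm (x - m) + 2 * h * (x - m) 0 i + h ^+ 2) / (2 * b)).
Proof. by rewrite /gauss_pdf -addrA sqnorm_line. Qed.

Lemma is_derive_gauss_line (m x : 'rV[R]_d) i (h : R) :
  is_derive h 1 (fun h => gauss_pdf m b (h *: delta_mx 0 i + x))
    (- ((h *: delta_mx 0 i + x - m) 0 i / b) * gauss_pdf m b (h *: delta_mx 0 i + x)).
Proof.
rewrite gauss_pdf_line; under eq_fun do rewrite gauss_pdf_line.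
have -> : (h *: delta_mx 0 i + x - m) 0 i = h + (x - m) 0 i.
  by rewrite !mxE !eqxx mulr1 addrA.
move: ((x - m) 0 i) (sqnorm _) gmax => z S C.
apply: is_derive_eq.
rewrite /= ?scaler1 /GRing.scale /=.
by field; rewrite gt_eqF.
Qed.

(** The bound is uniform in the centre [m]; multiplied by [q0] it dominates the derivative of
    [post]. With z = u^2 / (2 b), it follows from |u| <= (1 + u^2) / 2 = 1/2 + b z <= (1 + b) (1 +
    z) and 1 + z <= exp(z). *)
Lemma gauss_line_bound (m x : 'rV[R]_d) i (h : R) :
  `|- ((h *: delta_mx 0 i + x - m) 0 i / b) * gauss_pdf m b (h *: delta_mx 0 i + x)|
  <= gmax * ((1 + b) / b).
Proof.
set y := h *: _ + x; set u := (y - m) 0 i.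
have uS : u ^+ 2 <= sqnorm (y - m).
  by rewrite /sqnorm (bigD1 i)//= lerDl sumr_ge0// => j _; exact: sqr_ge0.
rewrite normrM normrN normrM normfV (gtr0_norm b_gt0) (ger0_norm (gauss_pdf_ge0 _ _ _)).
have e1 : gauss_pdf m b y <= gmax * expR (- u ^+ 2 / (2 * b)).
  rewrite /gauss_pdf ler_wpM2l ?gmax_ge0// ler_expR !mulNr lerN2 ler_wpM2r//.
  by rewrite invr_ge0 mulr_ge0// ltW.
have e2 : `|u| * expR (- u ^+ 2 / (2 * b)) <= 1 + b.
  set z := u ^+ 2 / (2 * b).
  have z0 : 0 <= z by rewrite divr_ge0 ?sqr_ge0// mulr_ge0// ltW.
  have uz : `|u| ^+ 2 = 2 * b * z.
    by rewrite real_normK ?num_real// /z; field; rewrite gt_eqF.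
  rewrite mulNr -/z -(@ler_pM2r _ (expR z)) ?expR_gt0// -mulrA -expRD addNr expR0 mulr1.
  apply: (@le_trans _ _ ((1 + b) * (1 + z))); last first.
    by rewrite ler_wpM2l ?expR_ge1Dx// addr_ge0// ltW.
  have := sqr_ge0 (`|u| - 1); have := normr_ge0 u; have := b_gt0.
  move: uz; move: `|u| => v vz bb v0 v1.
  have : 0 <= b * z by rewrite mulr_ge0// ltW.
  nra.
apply: (@le_trans _ _ (`|u| / b * (gmax * expR (- u ^+ 2 / (2 * b))))).
  by rewrite ler_wpM2l// divr_ge0// ltW.
have -> : `|u| / b * (gmax * expR (- u ^+ 2 / (2 * b))) =
    gmax * ((`|u| * expR (- u ^+ 2 / (2 * b))) / b) by ring.
by rewrite ler_wpM2l ?gmax_ge0// ler_wpM2r// invr_ge0 ltW.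
Qed.

(** The posterior mean of coordinate [i] of a x_0 - x, multiplied by [mix x]; differentiating the
    Gaussian factor under the integral produces it. *)
Definition drift i x : R := fine (\int[mu]_t (post x t * (a *: rv t - x) 0 i)%:E)%E.

Lemma is_derive_mix_line x i :
  is_derive (0 : R) 1 (fun h : R => mix (h *: delta_mx 0 i + x)) (drift i x / b).
Proof.
pose f (h : R) (t : tup) := post (h *: delta_mx 0 i + x) t.
have derf (h : R) (t : tup) : is_derive h 1 (f ^~ t)
    (q0 (rv t) * (- ((h *: delta_mx 0 i + x - a *: rv t) 0 i / b) *
       gauss_pdf (a *: rv t) b (h *: delta_mx 0 i + x))).
  exact: (is_deriveZ (q0 (rv t)) (is_derive_gauss_line (a *: rv t) x i h)).
have d1E (h : R) (t : tup) : partial1of2 f h t = q0 (rv t) * (- ((h *: delta_mx 0 i + x - a *: rv t) 0 i / b) *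
       gauss_pdf (a *: rv t) b (h *: delta_mx 0 i + x)).
  by rewrite partial1of2E; have := derf h t => /(@derive_val _ _ _ _ _ _ _).
pose G (t : tup) := gmax * ((1 + b) / b) * q0 (rv t).
have G0 t : 0 <= G t.
  by rewrite mulr_ge0 ?q0_ge0// mulr_ge0 ?gmax_ge0// divr_ge0 ?(ltW b_gt0)// addr_ge0// ltW.
have iG : mu.-integrable setT (EFin \o G).
  rewrite /G /comp; under eq_fun do rewrite EFinM.
  by apply: integrableZl => //; exact: integrable_q0.
have I0 : `]-1 : R, 1[%classic (0 : R) by rewrite /= in_itv /=; apply/andP; split; lra.
have intf h : `]-1, 1[%classic h -> mu.-integrable setT (EFin \o f h).
  by move=> _; exact: integrable_post.
have derf1 h t : `]-1, 1[%classic h -> setT t -> derivable (f ^~ t) h 1.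
  by move=> _ _; have := derf h t => /(@ex_derive _ _ _ _ _ _ _).
have Gub h t : `]-1, 1[%classic h -> setT t -> `|partial1of2 f h t| <= G t.
  move=> _ _; rewrite d1E normrM (ger0_norm (q0_ge0 _)) mulrC ler_wpM2r ?q0_ge0//.
  exact: gauss_line_bound.
have D := @differentiation_under_integral R _ _ mu f setT measurableT
  0 (-1) 1 I0 intf derf1 G G0 iG Gub.
have E := @derivable_under_integral R _ _ mu f setT measurableT
  0 (-1) 1 I0 intf derf1 G G0 iG Gub.
apply: DeriveDef; first exact: E.
rewrite -derive1E; transitivity (\int[mu]_(y in setT) (partial1of2 f)^~ y 0)%R.
  exact: D.
have ip : mu.-integrable setT (EFin \o (fun t => post x t * (a *: rv t - x) 0 i)).
  exact: integrable_post_coord.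
transitivity (\int[mu]_t (b^-1 * (post x t * (a *: rv t - x) 0 i)))%R; last first.
  by rewrite RintegralZl// mulrC.
apply: eq_Rintegral => t _; rewrite d1E scale0r add0r /post.
have -> : (x - a *: rv t) 0 i = - ((a *: rv t - x) 0 i) by rewrite !mxE opprB.
move: ((a *: rv t - x) 0 i) (q0 _) (gauss_pdf _ _ _) => z q p.
by field; rewrite gt_eqF.
Qed.

Lemma mix_scoreE x i : mix_score x 0 i = drift i x / b / mix x.
Proof.
rewrite mxE.
pose g (h : R) := mix (h *: delta_mx 0 i + x).
have g0 : g 0 = mix x by rewrite /g scale0r add0r.
have gx : 0 < g 0 by rewrite g0 mix_gt0.
have D : is_derive (0 : R) 1 (fun h => ln (g h)) (drift i x / b / mix x).
  have := @is_derive1_comp R (@ln R) g 0 _ _ (is_derive1_ln gx) (is_derive_mix_line x i).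
  by rewrite g0 mulrC.
transitivity ('D_1 (fun h => ln (g h)) 0); last by rewrite derive_val.
(* The directional derivative at [x] and the derivative at 0 of the restriction to the line are
   limits of the same difference quotient. *)
have E : (fun h : R => h^-1 *: (ln (mix (h *: delta_mx 0 i + x)) - ln (mix x) : R^o)) =
         (fun h : R => h^-1 *: (ln (g (h *: (1 : R^o) + 0)) - ln (g 0) : R^o)).
  by apply/funext => h; rewrite g0 addr0 /GRing.scale /= mulr1.
exact: (congr1 (fun F : R -> R^o => lim (F h @[h --> (0 : R)^'])) E).
Qed.

Lemma mix_driftE x i : drift i x = b * (mix_score x 0 i * mix x).
Proof. by rewrite mix_scoreE; field; rewrite !gt_eqF// mix_gt0. Qed.

Definition pmean (x : 'rV[R]_d) : 'rV[R]_d := x + b *: mix_score x.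

(** Tweedie's formula, multiplied by [mix x]: the mean of a x_0 - x is [drift], and [mix_driftE]
    says that this is b times the score times [mix x]. *)
Lemma post_centered x i : (\int[mu]_t (post x t * (a *: rv t - pmean x) 0 i)%:E = 0)%E.
Proof.
have ip := @integrable_post x; have ic := @integrable_post_coord x x i.
pose c := b * mix_score x 0 i.
transitivity (\int[mu]_t ((post x t * (a *: rv t - x) 0 i)%:E - c%:E * (post x t)%:E))%E.
  apply: eq_integral => t _; rewrite -EFinM -EFinB; congr (_%:E).
  by rewrite /pmean /c !mxE; ring.
rewrite integralB//; last exact: integrableZl.
rewrite integralZl// -mix_EFin -(fineK (integrable_fin_num measurableT ic)).
by rewrite -/(drift i x) mix_driftE -EFinM -EFinB /c mulrA subrr.
Qed.

(* Since the posterior mean of [a *: x0] is [pmean x] (Tweedie's formula), the cross term vanishes. *)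
Lemma post_pythagoras x v :
  (\int[mu]_t (post x t * sqnorm (a *: rv t - v))%:E =
   \int[mu]_t (post x t * sqnorm (a *: rv t - pmean x))%:E
   + (mix x * sqnorm (pmean x - v))%:E)%E.
Proof.
pose m := pmean x; pose K := sqnorm (m - v).
pose c i := 2 * (m - v) 0 i.
have ic i : mu.-integrable setT (fun t => (c i)%:E * (post x t * (a *: rv t - m) 0 i)%:E)%E.
  by apply: integrableZl => //; exact: integrable_post_coord.
have is_ : mu.-integrable setT
    (fun t => (\sum_i (c i)%:E * (post x t * (a *: rv t - m) 0 i)%:E)%E).
  by apply: integrable_sum => // i _; exact: ic.
have iK : mu.-integrable setT (fun t => K%:E * (post x t)%:E)%E.
  by apply: integrableZl => //; exact: integrable_post.
have iS := @integrable_post_sqnorm x m.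
transitivity (\int[mu]_t (((post x t * sqnorm (a *: rv t - m))%:E +
    K%:E * (post x t)%:E) + \sum_i (c i)%:E * (post x t * (a *: rv t - m) 0 i)%:E))%E.
  apply: eq_integral => t _; under [X in (_ + X)%E]eq_bigr do rewrite -EFinM.
  rewrite sumEFin -EFinM -!EFinD; congr (_%:E).
  rewrite /K /sqnorm mulrC (mulrC (post x t)) !mulr_suml -!big_split /=.
  apply: eq_bigr => i _; rewrite /c !mxE.
  by move: (post x t) (rv t 0 i) (m 0 i) (v 0 i) => p y z w; ring.
rewrite integralD//; last exact: integrableD.
rewrite integralD// integralZl//; last exact: integrable_post.
rewrite -mix_EFin -EFinM integral_sum// big1 ?adde0.
  by rewrite mulrC.
move=> i _; rewrite integralZl//; last exact: integrable_post_coord.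
by rewrite post_centered mule0.
Qed.

Lemma measurable_mix dS (S : measurableType dS) (x : S -> 'rV[R]_d) : vmeas x ->
  measurable_fun setT (fun s => mix (x s)).
Proof.
move=> mx; apply/measurable_EFinP.
rewrite (_ : _ \o _ = fun s => \int[mu]_t (post (x s) t)%:E)%E; last first.
  by apply/funext => s /=; rewrite mix_EFin.
apply: (measurable_fun_fubini_tonelli_F (m2 := mu)
  (fun p : S * tup => (post (x p.1) p.2)%:E)).
  apply/measurable_EFinP; apply: measurable_post_pair => //.
  exact: (vmeas_comp measurable_fst).
by move=> p; rewrite lee_fin post_ge0.
Qed.

(** The integrand is signed, so Tonelli is applied to its positive and negative parts; its
    integrability allows [fine] to be removed. *)
Lemma measurable_drift dS (S : measurableType dS) (x : S -> 'rV[R]_d) i : vmeas x ->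
  measurable_fun setT (fun s => drift i (x s)).
Proof.
move=> mx.
pose F (p : S * tup) := (post (x p.1) p.2 * (a *: rv p.2 - x p.1) 0 i)%:E.
have m1 := vmeas_comp (measurable_fst (T1 := S) (T2 := tup)) mx.
have mF : measurable_fun setT F.
  apply/measurable_EFinP; apply: measurable_funM.
    exact: measurable_post_pair.
  by apply: vmeasB => //; apply: vmeasZ; exact: vmeas_rv_comp.
apply/measurable_EFinP; rewrite (_ : _ \o _ = fun s =>
  (\int[mu]_t (F^\+ (s, t)) - \int[mu]_t (F^\- (s, t)))%E); last first.
  apply/funext => s /=; rewrite /drift.
  rewrite (fineK (integrable_fin_num measurableT (integrable_post_coord (x s) (x s) i))).
  rewrite [LHS]integralE; congr (_ - _)%E; apply: eq_integral => t _.
    by rewrite !funeposE.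
  by rewrite !funenegE.
apply: emeasurable_funB.
  apply: (measurable_fun_fubini_tonelli_F (m2 := mu) (F^\+)%E) => //.
  exact: measurable_funepos.
apply: (measurable_fun_fubini_tonelli_F (m2 := mu) (F^\-)%E) => //.
exact: measurable_funeneg.
Qed.

Lemma vmeas_score dS (S : measurableType dS) (x : S -> 'rV[R]_d) : vmeas x ->
  vmeas (fun s => mix_score (x s)).
Proof.
move=> mx i; under eq_fun do rewrite mix_scoreE.
apply: measurable_funM; first by apply: measurable_funM => //; exact: measurable_drift.
apply: measurable_funV_gt0 => [|s]; last exact: mix_gt0.
exact: measurable_mix.
Qed.

Lemma vmeas_pmean dS (S : measurableType dS) (x : S -> 'rV[R]_d) : vmeas x ->
  vmeas (fun s => pmean (x s)).
Proof. by move=> mx; apply: vmeasD => //; apply: vmeasZ; exact: vmeas_score. Qed.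

Definition post_var (x : 'rV[R]_d) : \bar R :=
  (\int[mu]_t (post x t * sqnorm (a *: rv t - pmean x))%:E)%E.

Lemma measurable_post_sqnorm dS (S : measurableType dS) (x v : S -> 'rV[R]_d) (t : S -> tup) :
  vmeas x -> vmeas v -> measurable_fun setT t ->
  measurable_fun setT (fun s => (post (x s) (t s) * sqnorm (a *: rv (t s) - v s))%:E).
Proof.
move=> mx mv mt; apply/measurable_EFinP; apply: measurable_funM.
  exact: measurable_post_pair.
by apply: measurable_sqnorm; apply: vmeasB => //; apply: vmeasZ; exact: vmeas_rv_comp.
Qed.

Lemma measurable_post_var : measurable_fun setT (fun s : tup => post_var (rv s)).
Proof.
apply: (measurable_fun_fubini_tonelli_F (m2 := mu)
  (fun p : tup * tup => (post (rv p.1) p.2 * sqnorm (a *: rv p.2 - pmean (rv p.1)))%:E)).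
  by apply: measurable_post_sqnorm => //; [|apply: vmeas_pmean]; exact: vmeas_rv_comp.
by move=> p; rewrite lee_fin mulr_ge0 ?post_ge0 ?sqnorm_ge0.
Qed.

Lemma post_var_ge0 x : (0 <= post_var x)%E.
Proof. by apply: integral_ge0 => t _; rewrite lee_fin mulr_ge0 ?post_ge0 ?sqnorm_ge0. Qed.

Definition fisherE : \bar R := (\int[mu]_t (mix (rv t) * sqnorm (mix_score (rv t)))%:E)%E.

Lemma fisherE_ge0 : (0 <= fisherE)%E.
Proof.
by apply: integral_ge0 => t _; rewrite lee_fin mulr_ge0 ?sqnorm_ge0// ltW// mix_gt0.
Qed.

Lemma sqnormBC (u v : 'rV[R]_d) : sqnorm (u - v) = sqnorm (v - u).
Proof. by rewrite /sqnorm; apply: eq_bigr => i _; rewrite !mxE -sqrrN opprB. Qed.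

Lemma int_post_sqnorm :
  (\int[mu]_x \int[mu]_t (post (rv x) t * sqnorm (a *: rv t - rv x))%:E = (d%:R * b)%:E)%E.
Proof.
rewrite (fubini_tonelli (fun p : tup * tup =>
  (post (rv p.1) p.2 * sqnorm (a *: rv p.2 - rv p.1))%:E)).
- transitivity (\int[mu]_t ((d%:R * b)%:E * (q0 (rv t))%:E))%E.
    apply: eq_integral => t _ /=.
    transitivity (\int[mu]_x ((q0 (rv t))%:E *
        (gauss_pdf (a *: rv t) b (rv x) * sqnorm (rv x - a *: rv t))%:E))%E.
      by apply: eq_integral => x _; rewrite -EFinM /post -mulrA sqnormBC.
    rewrite ge0_integralTZl ?q0_ge0//.
    + rewrite integral_gauss_sqnorm// subrr /sqnorm big1; last by move=> i _; rewrite mxE expr0n.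
      by rewrite addr0 muleC.
    + apply/measurable_EFinP; apply: measurable_funM; first exact: measurable_gauss_pdf_rv.
      by apply: measurable_sqnorm; apply: vmeasB; [exact: vmeas_rv|exact: vmeas_cst].
    + by move=> x; rewrite lee_fin mulr_ge0 ?gauss_pdf_ge0 ?sqnorm_ge0.
  rewrite ge0_integralTZl.
  + by case: q0P => _ _ -> _; rewrite mule1.
  + by rewrite mulr_ge0// ltW.
  + by apply/measurable_EFinP; exact: measurable_q0.
  + by move=> t; rewrite lee_fin q0_ge0.
- by apply: measurable_post_sqnorm => //; exact: vmeas_rv_comp.
- by move=> p; rewrite lee_fin mulr_ge0 ?post_ge0 ?sqnorm_ge0.
Qed.

(** Pythagoras at v = x: the noise x_n - a x_0 has mean square d b, and [pmean x - x] is b times the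
    score, which leaves the posterior variance and b^2 times the Fisher information. *)
Lemma post_var_fisher :
  (\int[mu]_x post_var (rv x) + (b ^+ 2)%:E * fisherE = (d%:R * b)%:E)%E.
Proof.
have mf : measurable_fun setT (fun t : tup => (mix (rv t) * sqnorm (mix_score (rv t)))%:E).
  apply/measurable_EFinP; apply: measurable_funM; first by apply: measurable_mix; exact: vmeas_rv.
  by apply: measurable_sqnorm; apply: vmeas_score; exact: vmeas_rv.
have f0 (t : tup) : (0 <= (mix (rv t) * sqnorm (mix_score (rv t)))%:E)%E.
  by rewrite lee_fin mulr_ge0 ?sqnorm_ge0// ltW// mix_gt0.
rewrite -int_post_sqnorm -ge0_integralTZl ?sqr_ge0// -ge0_integralTD.
- apply: eq_integral => x _; rewrite [RHS]post_pythagoras; congr (_ + _)%E.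
  by rewrite -EFinM /pmean (addrC (rv x)) addrK sqnormZ mulrCA.
- exact: measurable_post_var.
- by move=> x; exact: post_var_ge0.
- exact: measurable_funeM.
- by move=> x; rewrite mule_ge0// lee_fin sqr_ge0.
Qed.

(** Both terms of [post_var_fisher] are nonnegative with a finite sum, so [fine] in the definition
    of [fisher] discards no infinite value. *)
Lemma fisherE_fin : fisherE \is a fin_num.
Proof.
have := post_var_fisher; have := fisherE_ge0.
have : (0 <= \int[mu]_x post_var (rv x))%E by apply: integral_ge0 => x _; exact: post_var_ge0.
have b20 : 0 < b ^+ 2 by rewrite exprn_gt0.
case: fisherE => // v0 _; rewrite gt0_muley ?lte_fin//.
by case: (integral _ _ _) v0.
Qed.

Lemma int_post_varE :
  (\int[mu]_x post_var (rv x) = (d%:R * b - b ^+ 2 * fine fisherE)%:E)%E.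
Proof.
have := post_var_fisher; rewrite -[X in (_ * X)%E](fineK fisherE_fin) -EFinM => /esym e.
by rewrite EFinB e addeK.
Qed.

Lemma sqnorm_eq0 (u : 'rV[R]_d) : sqnorm u = 0 -> u = 0.
Proof.
move=> u0; apply/rowP => i; rewrite mxE; apply/eqP; rewrite -sqrf_eq0; apply/eqP.
have /psumr_eq0P : \sum_(i < d) u 0 i ^+ 2 = 0 by exact: u0.
by apply => // j _; exact: sqr_ge0.
Qed.

Lemma measurable_tuple_set1 (y : tup) : measurable [set y].
Proof.
have mS : measurable_fun setT (fun t : tup => sqnorm (rv t - rv y)).
  by apply: measurable_sqnorm; apply: vmeasB; [exact: vmeas_rv|exact: vmeas_cst].
have := mS measurableT _ (measurable_set1 0); rewrite setTI.
rewrite (_ : _ @^-1` _ = [set y])//; apply/seteqP; split => t /=.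
  move=> /sqnorm_eq0/eqP; rewrite subr_eq0 => /eqP e.
  exact: (can_inj (@rvK R d) e).
by move=> ->; rewrite subrr /sqnorm big1// => i _; rewrite mxE expr0n.
Qed.

(** If the integral vanished, some posterior would have zero variance and be carried by the point
    where a x_0 equals its mean. A point is Lebesgue null, so [q0] would be zero almost
    everywhere. *)
Lemma int_post_var_gt0 : (0 < d)%N -> a != 0 -> 0 < d%:R * b - b ^+ 2 * fine fisherE.
Proof.
move=> d0 a0; rewrite lt_neqAle; apply/andP; split; last first.
  by rewrite -lee_fin -int_post_varE; apply: integral_ge0 => x _; exact: post_var_ge0.
apply/negP => /eqP V0.
have : (\int[mu]_x `|post_var (rv x)| = 0)%E.
  under eq_integral do rewrite gee0_abs ?post_var_ge0//.
  by rewrite int_post_varE -V0.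
move/ae_eq_integral_abs => /(_ measurableT measurable_post_var) H.
(* If no such point existed, an impossible condition would hold almost everywhere, hence so would
   [q0 = 0]. *)
have [x xV] : exists x : tup, post_var (rv x) = 0%E.
  apply: contrapT => /forallNP nV.
  have H' : {ae mu, forall t, setT t -> (q0 (rv t))%:E = 0%E}.
    by move: H; apply: filterS => t /(_ I) /nV.
  exact: (q0_not_ae0 H').
have mS := @measurable_post_sqnorm _ tup (fun=> rv x) (fun=> pmean (rv x)) id
  (@vmeas_cst _ _ _ _ _) (@vmeas_cst _ _ _ _ _) (@measurable_id _ _ _).
have n0 t : (0 <= (post (rv x) t * sqnorm (a *: rv t - pmean (rv x)))%:E)%E.
  by rewrite lee_fin mulr_ge0 ?post_ge0 ?sqnorm_ge0.
have : (\int[mu]_t `|(post (rv x) t * sqnorm (a *: rv t - pmean (rv x)))%:E| = 0)%E.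
  under eq_integral do rewrite gee0_abs//.
  exact: xV.
move/ae_eq_integral_abs => /(_ measurableT mS) {}H.
pose y := tuple_of_rv (a^-1 *: pmean (rv x)).
have H2 : {ae mu, forall t, t <> y}.
  exists [set y]; split.
  - exact: measurable_tuple_set1.
  - exact: lebRd_set1_gt0.
  - by move=> t /= /contrapT.
apply: q0_not_ae0; apply: filterS2 H H2 => t /(_ I) [] ps0 ty _.
have /orP[pt0|/eqP s0] : (post (rv x) t == 0) || (sqnorm (a *: rv t - pmean (rv x)) == 0).
  by rewrite -mulf_eq0 ps0.
  move: pt0; rewrite mulf_eq0 => /orP[/eqP -> //|].
  by rewrite gt_eqF// gauss_pdf_gt0.
exfalso; apply: ty; rewrite /y; apply/(can_inj (@rvK R d)).
rewrite tuple_of_rvK; have /eqP := sqnorm_eq0 s0.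
by rewrite subr_eq0 => /eqP <-; rewrite scalerA mulVf// scale1r.
Qed.

End Score.

(** * Comparison of divergences *)

Section KLcompare.
Context {R : realType} {dT : measure_display} {T : measurableType dT}.
Local Open Scope ereal_scope.

Lemma ln_le_subr1 (x : R) : (0 < x)%R -> (1 + ln x <= x)%R.
Proof. by move=> x0; rewrite -[leRHS](@lnK _ x) ?posrE// expR_ge1Dx. Qed.

(** [ln_le_subr1] at [x^-1] gives x ln x >= x - 1. The bound controls negative parts of entropy
    integrands on a finite measure. *)
Lemma mul_ln_ge (x : R) : (0 <= x)%R -> (-1 <= x * ln x)%R.
Proof.
rewrite le_eqVlt => /predU1P[<-|x0]; first by rewrite mul0r; lra.
have xi : (0 < x^-1)%R by rewrite invr_gt0.
have := ln_le_subr1 xi; rewrite lnV ?posrE// => h.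
have : (x * (1 - ln x) <= x * x^-1)%R by rewrite ler_wpM2l// ltW.
by rewrite mulfV ?gt_eqF// mulrBr mulr1; lra.
Qed.

Lemma daniell_density (m : {measure set T -> \bar R}) (f : T -> R) :
  measurable_fun setT f -> (forall x, 0 <= f x)%R ->
  daniell (fun g => \int[m]_x ((f x)%:E * g x)).
Proof.
move=> mf f0.
have mI g : nnm g -> measurable_fun setT (fun x => (f x)%:E * g x).
  by move=> [mg _]; apply: emeasurable_funM => //; exact/measurable_EFinP.
have I0 g : (forall x, 0 <= g x) -> forall x, 0 <= (f x)%:E * g x.
  by move=> g0 x; rewrite mule_ge0// lee_fin.
split.
- by move=> g g0; apply: integral_ge0 => x _; exact: I0.
- move=> g h ng nh; have [_ g0] := ng; have [_ h0] := nh; rewrite -ge0_integralTD.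
  + by apply: eq_integral => x _; rewrite ge0_muleDr.
  + exact: mI.
  + exact: I0.
  + exact: mI.
  + exact: I0.
- move=> c g c0 ng; have [_ g0] := ng; rewrite -ge0_integralTZl//.
  + by apply: eq_integral => x _; rewrite muleCA.
  + exact: mI.
  + exact: I0.
- move=> g h ng nh gh; have [_ g0] := ng; apply: ge0_le_integralT.
  + exact: mI.
  + exact: I0.
  + exact: mI.
  + by move=> x; rewrite lee_wpmul2l// lee_fin.
- move=> g ng ndg; rewrite -monotone_convergence//.
  + apply: eq_integral => x _; rewrite limeMl//.
    by apply: ereal_nondecreasing_is_cvgn; exact: ndg.
  + by move=> n; exact: mI.
  + by move=> n x _; apply: I0; have [] := ng n.
  + by move=> x _ n m' nm; rewrite lee_wpmul2l// ?lee_fin//; exact: ndg.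
Qed.

Lemma integral_in_density (m : {measure set T -> \bar R}) (f : T -> R) A :
  \int[m]_(x in A) (f x)%:E = \int[m]_x ((f x)%:E * (\1_A x : R)%:E).
Proof.
rewrite integral_mkcond; apply: eq_integral => x _.
by rewrite /patch indicE; case: (x \in A); rewrite ?mule1 ?mule0.
Qed.

(** [EQ] is the forward expectation, [P] the optimal law, [P'] the competitor and [r] the density of
    [P'] relative to [P]. [B] and [A] are the weighted squares of [P] and [P'], and [k] collects the
    normalising constants. The expectation of [A] is only bounded below, by [aq], and [abk]
    expresses E[ln r] <= 0. *)
Variables (EQ : (T -> \bar R) -> \bar R) (P P' : {measure set T -> \bar R}).
Variables (r A B : T -> R) (k bq aq : R).
Hypothesis DQ : daniell EQ.
Hypothesis EQ1 : EQ (cst 1) = 1.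
Hypothesis PT : P setT < +oo.
Hypothesis PT' : P' setT < +oo.
Hypothesis mr : measurable_fun setT r.
Hypothesis r0 : (forall x, 0 < r x)%R.
Hypothesis rP : forall g, nnm g -> \int[P']_x g x = \int[P]_x ((r x)%:E * g x).
Hypothesis mA : measurable_fun setT A.
Hypothesis mB : measurable_fun setT B.
Hypothesis A0 : (forall x, 0 <= A x)%R.
Hypothesis B0 : (forall x, 0 <= B x)%R.
Hypothesis lnr : (forall x, ln (r x) = B x - A x + k)%R.
Hypothesis EQB : EQ (EFin \o B) = bq%:E.
Hypothesis EQA : aq%:E <= EQ (EFin \o A).
Hypothesis abk : (bq + k <= aq)%R.

Lemma nnm_EFin (f : T -> R) : measurable_fun setT f -> (forall x, 0 <= f x)%R ->
  nnm (EFin \o f).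
Proof. by move=> mf f0; split=> [|x]; [exact/measurable_EFinP|rewrite lee_fin]. Qed.

Lemma integral_density_change (h : T -> R) : measurable_fun setT h ->
  \int[P']_x (h x)%:E = \int[P]_x (r x * h x)%:E.
Proof.
move=> mh.
have mh' : measurable_fun setT (EFin \o h) by exact/measurable_EFinP.
have np : nnm (fun x => (EFin \o h)^\+ x).
  by split=> [|x]; [exact: measurable_funepos|exact: funepos_ge0].
have nn : nnm (fun x => (EFin \o h)^\- x).
  by split=> [|x]; [exact: measurable_funeneg|exact: funeneg_ge0].
rewrite [LHS]integralE [RHS]integralE (rP np) (rP nn); congr (_ - _);
  apply: eq_integral => x _; rewrite ?funeposE ?funenegE /=.
  by rewrite EFinM maxe_pMr// ?mule0// lee_fin ltW.
by rewrite -mulrN EFinM maxe_pMr// ?mule0// lee_fin ltW.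
Qed.

Lemma integrable_of_lower (m : {measure set T -> \bar R}) (h : T -> R) : m setT < +oo ->
  measurable_fun setT h -> (forall x, -1 <= h x)%R -> \int[m]_x (h x)%:E < +oo ->
  m.-integrable setT (EFin \o h).
Proof.
move=> mT mh h1 hoo.
have mh' : measurable_fun setT (EFin \o h) by exact/measurable_EFinP.
have neg : \int[m]_x (EFin \o h)^\- x < +oo.
  apply: (@le_lt_trans _ _ (\int[m]_x cst 1 x)); last by rewrite integral_cst// mul1e.
  apply: ge0_le_integralT => //; first exact: measurable_funeneg.
  move=> x; rewrite funenegE /= ge_max !lee_fin ler01 andbT.
  by have := h1 x; lra.
have neg0 : 0 <= \int[m]_x (EFin \o h)^\- x by apply: integral_ge0.
apply/integrableP; split => //.
rewrite (eq_integral (fun x => (EFin \o h)^\+ x + (EFin \o h)^\- x)); last first.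
  by move=> x _; rewrite -[LHS]/((abse \o (EFin \o h)) x) fune_abse.
rewrite ge0_integralTD//; [|exact: measurable_funepos|exact: measurable_funeneg].
rewrite lte_add_pinfty//.
move: hoo; rewrite integralE; move: neg neg0.
case: (integral m setT (fun x => (EFin \o h)^\- x)) => // z _ _.
by case: (integral m setT (fun x => (EFin \o h)^\+ x)) => // z' _; rewrite ltry.
Qed.

(* A density f of the law [EQ] with respect to [P'] gives the density r f with respect
   to [P]. The negative part of f ln (r f) is integrable because [P] is finite and
   x ln x >= -1, so the identity f ln (r f) + f A = f ln f + f B + k f makes both terms on
   the left integrable. *)
Lemma KL_le_of_ratio : KL (fun A => EQ (fun x => (\1_A x : R)%:E)) P <=
  KL (fun A => EQ (fun x => (\1_A x : R)%:E)) P'.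
Proof.
apply/ereal_infP => _ [f [mf f0 Qf] <-].
have Ef g : nnm g -> \int[P']_x ((f x)%:E * g x) = EQ g.
  move=> ng; apply: (daniell_eq (daniell_density P' mf f0) DQ _ ng) => D mD.
  by rewrite Qf// integral_in_density.
pose fs x := (r x * f x)%R.
have mfs : measurable_fun setT fs by exact: measurable_funM.
have fs0 x : (0 <= fs x)%R by rewrite mulr_ge0// ltW.
apply: (@le_trans _ _ (\int[P]_x (fs x * ln (fs x))%:E)).
  apply: ereal_inf_lbound; exists fs => //; split=> // D mD.
  rewrite integral_in_density -Ef; last exact: nnm_indic.
  have nf : nnm (fun x => (f x)%:E * (\1_D x : R)%:E).
    have [m1 m0] := nnm_indic (R := R) mD.
    split=> [|x]; last by rewrite mule_ge0// lee_fin.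
    by apply: emeasurable_funM => //; exact/measurable_EFinP.
  by rewrite (rP nf); apply: eq_integral => x _; rewrite muleA -EFinM.
set y := (X in _ <= X).
have [->|yoo] := eqVneq y +oo; first exact: leey.
have {}yoo : y < +oo by rewrite lt_neqAle yoo leey.
pose v x := (f x * ln (f x))%R; pose u x := (f x * ln (fs x))%R.
have mln (h : T -> R) : measurable_fun setT h -> measurable_fun setT (fun x => ln (h x)).
  by move=> mh; apply: measurableT_comp => //; exact: measurable_ln.
have mv : measurable_fun setT v by apply: measurable_funM => //; exact: mln.
have mu : measurable_fun setT u by apply: measurable_funM => //; exact: mln.
have iv : P'.-integrable setT (EFin \o v).
  by apply: integrable_of_lower => // x; exact: mul_ln_ge.
have fsuE x : (fs x * ln (fs x) = r x * u x)%R by rewrite /fs /u mulrA.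
under eq_integral do rewrite fsuE.
rewrite -integral_density_change//.
have uE x : (u x + f x * A x = v x + (f x * B x + k * f x))%R.
  have [fx0|fxn0] := eqVneq (f x) 0%R; first by rewrite /u /v fx0 !(mul0r, mulr0, addr0).
  have fx : (0 < f x)%R by rewrite lt_neqAle eq_sym fxn0 f0.
  by rewrite /u /v /fs lnM ?posrE// lnr; ring.
have ifB : P'.-integrable setT (fun x => (f x * B x)%:E).
  apply/integrableP; split; first by apply/measurable_EFinP; exact: measurable_funM.
  under eq_integral do rewrite gee0_abs ?lee_fin ?mulr_ge0// EFinM.
  by rewrite (Ef _ (nnm_EFin mB B0)) EQB ltry.
have if1 : \int[P']_x (f x)%:E = 1.
  rewrite -EQ1 -Ef; last by split.
  by apply: eq_integral => x _; rewrite mule1.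
have iF : P'.-integrable setT (EFin \o f).
  apply/integrableP; split; first exact/measurable_EFinP.
  by under eq_integral do rewrite /= ger0_norm//; rewrite if1 ltry.
have iK : P'.-integrable setT (fun x => (k * f x)%:E).
  by under eq_fun do rewrite EFinM; exact: integrableZl.
have iS : P'.-integrable setT (fun x => (f x * B x)%:E + (k * f x)%:E).
  exact: integrableD.
have iR : P'.-integrable setT (fun x => (v x)%:E + ((f x * B x)%:E + (k * f x)%:E)).
  exact: integrableD.
have IR : \int[P']_x ((v x)%:E + ((f x * B x)%:E + (k * f x)%:E)) = y + (bq + k)%:E.
  rewrite integralD// integralD//; congr (_ + _).
  under [in X in _ + X]eq_integral do rewrite EFinM.
  rewrite integralZl// if1 mule1; under eq_integral do rewrite EFinM.
  by rewrite (Ef _ (nnm_EFin mB B0)) EQB EFinD.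
have nun : nnm (fun x => (EFin \o u)^\- x).
  by split=> [|x]; [apply: measurable_funeneg; exact/measurable_EFinP|exact: funeneg_ge0].
have iun : P'.-integrable setT (fun x => (EFin \o u)^\- x).
  apply/integrableP; split; first by case: nun.
  under eq_integral do rewrite gee0_abs ?funeneg_ge0//.
  rewrite (rP nun); apply: (@le_lt_trans _ _ (\int[P]_x cst 1 x)); last first.
    by rewrite integral_cst// mul1e.
  have [mn n0] := nun.
  apply: ge0_le_integralT => //.
  - by apply: emeasurable_funM => //; exact/measurable_EFinP.
  - by move=> x; rewrite mule_ge0// lee_fin ltW.
  - move=> x; rewrite funenegE /= maxe_pMr ?lee_fin ?(ltW (r0 x))//.
    rewrite mule0 ge_max -EFinM mulrN -fsuE !lee_fin ler01 andbT.
    by have := mul_ln_ge (fs0 x); lra.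
(* Since [f * A] is nonnegative, [u] is at most the integrable right-hand side w of [uE]; hence |u|
   is at most |w| plus the negative part of [u]. *)
have iu : P'.-integrable setT (EFin \o u).
  apply: le_integrable (integrableD measurableT (integrable_abse iR) iun) => //.
    exact/measurable_EFinP.
  move=> x _; have := uE x; set w := (v x + _)%R => wE.
  rewrite [leRHS]gee0_abs; last first.
    by apply: adde_ge0; [exact: abse_ge0|exact: funeneg_ge0].
  rewrite /= funenegE /= -/w -EFin_max -EFinD lee_fin.
  have fA0 : (0 <= f x * A x)%R by rewrite mulr_ge0.
  have wn := ler_norm w; have wn0 := normr_ge0 w.
  move: wE wn wn0 fA0; move: w (u x) (f x * A x)%R => w z fA wE wn wn0 fA0.
  by case: (lerP 0%R z) => z0; [rewrite (ger0_norm z0)|rewrite (ltr0_norm z0)];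
    case: (lerP (- z)%R 0%R) => z1; lra.
have ifA : P'.-integrable setT (fun x => (f x * A x)%:E).
  apply: (@eq_integrable _ _ _ _ _ measurableT
    (fun x => ((v x)%:E + ((f x * B x)%:E + (k * f x)%:E)) - (u x)%:E)).
    by move=> x _; rewrite -!EFinD; congr (_%:E); have := uE x; lra.
  exact: integrableB.
have IA : \int[P']_x (f x * A x)%:E = EQ (EFin \o A).
  by rewrite -(Ef _ (nnm_EFin mA A0)); apply: eq_integral => x _; rewrite EFinM.
have IU : \int[P']_x (u x)%:E + \int[P']_x (f x * A x)%:E = y + (bq + k)%:E.
  rewrite -IR -integralD//; apply: eq_integral => x _.
  by rewrite -!EFinD uE.
have fy : y \is a fin_num by exact: integrable_fin_num.
have fu : \int[P']_x (u x)%:E \is a fin_num by exact: integrable_fin_num.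
have fA : \int[P']_x (f x * A x)%:E \is a fin_num by exact: integrable_fin_num.
move: IU EQA; rewrite -IA -(fineK fy) -(fineK fu) -(fineK fA) -!EFinD !lee_fin.
move: (fine y) (fine _) (fine _) => y' u' a' [] E aE.
by move: abk E aE; lra.
Qed.

End KLcompare.

(** * Mean-square errors of the reverse steps *)

Section Level.
Context {R : realType} {d N : nat} (beta lam : nat -> R) (q0 : 'rV[R]_d -> R).
Hypothesis d_gt0 : (0 < d)%N.
Hypothesis N_gt0 : (0 < N)%N.
Hypothesis beta01 : forall n, (1 <= n <= N)%N -> 0 < beta n < 1.
Hypothesis lamP : forall n, (1 <= n <= N)%N -> 0 <= lam n /\ lam n ^+ 2 <= bbar beta n.-1.
Hypothesis q0P : is_density_2mom q0.

Lemma gauss_int_sqnorm (m v : 'rV[R]_d) (l : R) : 0 <= l ->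
  gauss_int m l (fun y => (sqnorm (y - v))%:E) = (d%:R * l + sqnorm (m - v))%:E.
Proof.
move=> l0; rewrite /gauss_int; have [->|ln0] := eqVneq l 0; first by rewrite mulr0 add0r.
by rewrite -integral_gauss_sqnorm ?lt_neqAle 1?eq_sym ?ln0.
Qed.

Section fixed.
Variable n : nat.
Hypothesis nN : (1 <= n <= N)%N.

Let ra : R := Num.sqrt (abar beta n).
Let b : R := bbar beta n.
Let cc : R := Num.sqrt (bbar beta n.-1 - lam n ^+ 2) / Num.sqrt b.
Let kap : R := Num.sqrt (abar beta n.-1) / ra - cc.

Let b_gt0 : 0 < b. Proof. exact: (bbar_gt0 beta01 nN). Qed.
Let ra_gt0 : 0 < ra.
Proof. by rewrite sqrtr_gt0; apply: (abar_gt0 beta01); case/andP: nN. Qed.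

(** The mean is expressed through [ra *: t] because [pmean] is the posterior mean of this multiple
    of x_0. *)
Lemma mu_tildeE (x t : 'rV[R]_d) :
  mu_tilde beta lam n x t = kap *: (ra *: t) + cc *: x.
Proof.
rewrite /mu_tilde -/ra -/b -/cc /kap scalerBr scalerA addrCA scalerA addrC.
congr (_ + _); rewrite -scalerBl; congr (_ *: _).
by rewrite mulrBl divfK ?gt_eqF.
Qed.

Lemma mu_starE x : mu_star beta lam q0 n x =
  kap *: pmean q0 ra b x + cc *: x.
Proof.
rewrite /mu_star mu_tildeE -/ra (scalerA ra) mulfV ?gt_eqF// scale1r.
by [].
Qed.

(** Identifies the squared difference of roots in [sigma2_star]: the root of abar_n is that of
    abar_(n-1) times that of alpha_n. *)
Lemma kap2b : kap ^+ 2 * b =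
  (Num.sqrt (b / (1 - beta n)) - Num.sqrt (bbar beta n.-1 - lam n ^+ 2)) ^+ 2.
Proof.
have /andP[b0 b1] := beta01 nN.
have al0 : 0 < 1 - beta n by rewrite subr_gt0.
rewrite -[X in _ * X](sqr_sqrtr (ltW b_gt0)) -exprMn; congr (_ ^+ 2).
rewrite /kap mulrBl /cc divfK ?gt_eqF ?sqrtr_gt0//; congr (_ - _).
have -> : ra = Num.sqrt (abar beta n.-1) * Num.sqrt (1 - beta n).
  case: n nN al0 @ra => //= m mN al0; rewrite abarS sqrtrM// ltW//.
  by apply: (abar_gt0 beta01); rewrite ltnW.
rewrite (sqrtrM _ (ltW b_gt0)) sqrtrV ?(ltW al0)//.
have ra' : 0 < Num.sqrt (abar beta n.-1).
  rewrite sqrtr_gt0; apply: (abar_gt0 beta01); case/andP: nN => _.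
  exact: leq_trans (leq_pred _).
by field; rewrite !gt_eqF// sqrtr_gt0.
Qed.

(** The first root is strictly larger, because bbar_n - alpha_n bbar_(n-1) = beta_n > 0. Hence
    [mu_tilde] really depends on x_0. *)
Lemma kap_neq0 : kap != 0.
Proof.
have /andP[b0 b1] := beta01 nN.
have al0 : 0 < 1 - beta n by rewrite subr_gt0.
suff : 0 < kap ^+ 2 * b.
  by apply: contraTneq => ->; rewrite expr0n /= mul0r ltxx.
have nP : (n.-1 <= N)%N by case/andP: nN => _; exact: leq_trans (leq_pred _).
rewrite kap2b exprn_even_gt0//= subr_eq0 gt_eqF// ltr_sqrt; last by rewrite divr_gt0.
have lam2 : 0 <= lam n ^+ 2 by exact: sqr_ge0.
apply: (@le_lt_trans _ _ (bbar beta n.-1)); first by rewrite gerBl.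
rewrite ltr_pdivlMr// /b /bbar.
have -> : abar beta n = abar beta n.-1 * (1 - beta n).
  by case: n nN {al0 b0 b1} => //= m _; rewrite abarS.
by have := abar_gt0 beta01 nP; nra.
Qed.

(** By [int_post_varE], the mean square error of [pmean] as an estimate of [ra] times x_0. *)
Let V : R := d%:R * b - b ^+ 2 * fisher beta q0 n.

Lemma V_gt0 : 0 < V.
Proof. by apply: (int_post_var_gt0 b_gt0 q0P d_gt0); rewrite gt_eqF. Qed.

Lemma sigma2_starE : d%:R * sigma2_star beta lam q0 n = d%:R * lam n ^+ 2 + kap ^+ 2 * V.
Proof.
rewrite /sigma2_star -/b -kap2b /V; field.
by rewrite pnatr_eq0 -lt0n.
Qed.

Lemma sigma2_star_gt0 : 0 < sigma2_star beta lam q0 n.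
Proof.
rewrite -(@pmulr_rgt0 _ d%:R) ?ltr0n// sigma2_starE ltr_wpDl//.
  by rewrite mulr_ge0// sqr_ge0.
by rewrite mulr_gt0 ?V_gt0// exprn_even_gt0//= kap_neq0.
Qed.

Lemma mu_star_meas : rmeas_vec (mu_star beta lam q0 n).
Proof.
apply/measurable_rvP; rewrite -/(vmeas _).
have -> : (fun t : d.-tuple R => mu_star beta lam q0 n (rv t)) =
  (fun t => kap *: pmean q0 ra b (rv t) + cc *: rv t).
  by apply/funext => t; rewrite mu_starE.
apply: vmeasD; last by apply: vmeasZ; exact: vmeas_rv.
by apply: vmeasZ; apply: (vmeas_pmean ra b_gt0 q0P); exact: vmeas_rv.
Qed.

Definition sqdev (v : 'rV[R]_d -> 'rV[R]_d) (a : nat -> 'rV[R]_d) : \bar R :=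
  (sqnorm (a n.-1 - v (a n)))%:E.

Lemma pnn_sqdev v : rmeas_vec v -> pnn (sqdev v).
Proof.
move=> mv; split=> [dS S a ma|a]; last by rewrite lee_fin sqnorm_ge0.
apply/measurable_EFinP; apply: measurable_sqnorm; apply: vmeasB => //.
exact: (pvmeas_coord n mv).
Qed.

(** Bias and variance: the noise of the transition contributes d lambda_n^2, the uncertainty about
    x_0 contributes [kap ^+ 2 * V], and the last term is the price of using [w] instead of the
    posterior mean. *)
Lemma fwd_exp_sqdev (w : 'rV[R]_d -> 'rV[R]_d) : rmeas_vec w ->
  fwd_exp N beta lam q0 (sqdev (fun x => kap *: w x + cc *: x)) =
  ((d%:R * lam n ^+ 2 + kap ^+ 2 * V)%:E + (kap ^+ 2)%:E *
   \int[@lebRd R d]_x (mix q0 ra b (rv x) * sqnorm (pmean q0 ra b (rv x) - w (rv x)))%:E)%E.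
Proof.
move=> mw; have [mq q00 q01 q02] := q0P.
have vw : vmeas (fun t => w (@rv R d t)) by apply/measurable_rvP.
pose v x := kap *: w x + cc *: x.
have mv : rmeas_vec v.
  apply/measurable_rvP; rewrite -/(vmeas _); apply: vmeasD; first exact: vmeasZ.
  by apply: vmeasZ; exact: vmeas_rv.
have k20 : 0 <= kap ^+ 2 by exact: sqr_ge0.
have D0 : 0 <= d%:R * lam n ^+ 2 by rewrite mulr_ge0// sqr_ge0.
have mp : measurable_fun setT (fun p : d.-tuple R * d.-tuple R =>
    (post q0 ra b (rv p.1) p.2 * sqnorm (ra *: rv p.2 - w (rv p.1)))%:E).
  apply: (measurable_post_sqnorm ra b q0P (x := fun p => rv p.1) (v := fun p => w (rv p.1))) => //.
    exact: (vmeas_rv_comp measurable_fst).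
  exact: (vmeas_comp measurable_fst vw).
have p0 (p : d.-tuple R * d.-tuple R) :
    (0 <= (post q0 ra b (rv p.1) p.2 * sqnorm (ra *: rv p.2 - w (rv p.1)))%:E)%E.
  by rewrite lee_fin mulr_ge0 ?(post_ge0 ra b q0P) ?sqnorm_ge0.
have mg t : measurable_fun setT (fun x : d.-tuple R =>
    (gauss_pdf (ra *: rv t) b (rv x) * sqnorm (ra *: rv t - w (rv x)))%:E).
  apply/measurable_EFinP; apply: measurable_funM; first exact: measurable_gauss_pdf_rv.
  by apply: measurable_sqnorm; apply: vmeasB => //; exact: vmeas_cst.
have g0 t (x : d.-tuple R) :
    (0 <= (gauss_pdf (ra *: rv t) b (rv x) * sqnorm (ra *: rv t - w (rv x)))%:E)%E.
  by rewrite lee_fin mulr_ge0 ?gauss_pdf_ge0 ?sqnorm_ge0.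
have mG : measurable_fun setT (fun t : d.-tuple R => \int[@lebRd R d]_x
    (post q0 ra b (rv x) t * sqnorm (ra *: rv t - w (rv x)))%:E)%E.
  exact: (measurable_fun_fubini_tonelli_G (m1 := @lebRd R d) _ mp p0).
transitivity (\int[@lebRd R d]_t ((d%:R * lam n ^+ 2)%:E * (q0 (rv t))%:E +
  (kap ^+ 2)%:E * \int[@lebRd R d]_x
    (post q0 ra b (rv x) t * sqnorm (ra *: rv t - w (rv x)))%:E))%E.
  rewrite /sqdev (fwd_exp_pair beta01 lamP (H := fun y x => (sqnorm (y - v x))%:E) q0 nN); last first.
    exact: (pnn_sqdev mv).
  apply: eq_integral => t _.
  rewrite (@gauss_int_eq _ _ _ _ _ (fun x => (d%:R * lam n ^+ 2 +
      kap ^+ 2 * sqnorm (ra *: rv t - w x))%:E)); last first.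
    move=> x; rewrite gauss_int_sqnorm ?sqr_ge0//; congr (_ + _)%:E.
    by rewrite mu_tildeE /v opprD addrACA subrr addr0 -scalerBr sqnormZ.
  rewrite /gauss_int -/b (gt_eqF b_gt0) -/ra.
  transitivity ((q0 (rv t))%:E * ((d%:R * lam n ^+ 2)%:E + (kap ^+ 2)%:E *
     \int[@lebRd R d]_x (gauss_pdf (ra *: rv t) b (rv x) * sqnorm (ra *: rv t - w (rv x)))%:E))%E.
    congr (_ * _)%E.
    rewrite -ge0_integralTZl//.
    rewrite -[X in (X + _)%E]mule1 -(integral_gauss_pdf (ra *: rv t) b_gt0) -ge0_integralTZl//; first last.
    - by move=> x; rewrite lee_fin gauss_pdf_ge0.
    - by apply/measurable_EFinP; exact: measurable_gauss_pdf_rv.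
    rewrite -ge0_integralTD//; first last.
    - by move=> x; rewrite mule_ge0.
    - by apply: measurable_funeM; exact: mg.
    - by move=> x; rewrite mule_ge0// lee_fin gauss_pdf_ge0.
    - by apply: measurable_funeM; apply/measurable_EFinP; exact: measurable_gauss_pdf_rv.
    apply: eq_integral => x _; rewrite -!EFinM -EFinD; congr (_%:E).
    move: (gauss_pdf _ _ _) (sqnorm _) (d%:R * _) => p S D; ring.
  rewrite ge0_muleDr ?lee_fin//; last by rewrite mule_ge0// integral_ge0.
  rewrite muleC; congr (_ + _)%E; rewrite muleCA; congr (_ * _)%E.
  rewrite -ge0_integralTZl//.
  by apply: eq_integral => x _; rewrite -EFinM mulrA.
rewrite ge0_integralTD; first last.
- by move=> t; rewrite mule_ge0// integral_ge0// => x _; exact: (p0 (x, t)).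
- exact: measurable_funeM.
- by move=> t; rewrite mule_ge0// lee_fin.
- by apply: measurable_funeM; exact/measurable_EFinP.
rewrite ge0_integralTZl//; [|exact/measurable_EFinP|by move=> x; rewrite lee_fin].
rewrite q01 mule1 ge0_integralTZl//; last first.
  by move=> t; rewrite integral_ge0// => x _; exact: (p0 (x, t)).
(* With the integral over x_0 inside, x_n is fixed and [post_pythagoras] applies. *)
rewrite -(fubini_tonelli (m1 := @lebRd R d) (m2 := @lebRd R d) _ mp p0) /=.
have mx : measurable_fun setT (fun x : d.-tuple R =>
    (mix q0 ra b (rv x) * sqnorm (pmean q0 ra b (rv x) - w (rv x)))%:E).
  apply/measurable_EFinP; apply: measurable_funM.
    by apply: (measurable_mix ra b_gt0 q0P); exact: vmeas_rv.
  apply: measurable_sqnorm; apply: vmeasB => //.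
  by apply: (vmeas_pmean ra b_gt0 q0P); exact: vmeas_rv.
have x0 (x : d.-tuple R) :
    (0 <= (mix q0 ra b (rv x) * sqnorm (pmean q0 ra b (rv x) - w (rv x)))%:E)%E.
  by rewrite lee_fin mulr_ge0 ?sqnorm_ge0// ltW// mix_gt0.
under eq_integral do rewrite (post_pythagoras ra b_gt0 q0P).
rewrite ge0_integralTD//; first last.
- by move=> x; exact: (post_var_ge0 ra b q0P).
- exact: (measurable_post_var ra b_gt0 q0P).
rewrite (int_post_varE ra b_gt0 q0P) ge0_muleDr//; last 2 first.
- by rewrite lee_fin; exact: (ltW V_gt0).
- by apply: integral_ge0 => x _; exact: x0.
by rewrite addeA -EFinM -EFinD.
Qed.

Lemma fwd_exp_mu_star :
  fwd_exp N beta lam q0 (sqdev (mu_star beta lam q0 n)) =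
  (d%:R * sigma2_star beta lam q0 n)%:E.
Proof.
have -> : mu_star beta lam q0 n = fun x => kap *: pmean q0 ra b x + cc *: x.
  by apply/funext => x; rewrite mu_starE.
rewrite fwd_exp_sqdev; last first.
  by apply/measurable_rvP; apply: (vmeas_pmean ra b_gt0 q0P); exact: vmeas_rv.
rewrite sigma2_starE integral0_eq ?mule0 ?adde0// => x _.
by rewrite subrr /sqnorm big1 ?mulr0// => i _; rewrite mxE expr0n.
Qed.

(** As [kap] is nonzero, every [v] has the form treated by [fwd_exp_sqdev], whose last term is
    nonnegative. *)
Lemma fwd_exp_mu_ge v : rmeas_vec v ->
  ((d%:R * sigma2_star beta lam q0 n)%:E <= fwd_exp N beta lam q0 (sqdev v))%E.
Proof.
move=> mv; pose w x := kap^-1 *: (v x - cc *: x).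
have -> : v = fun x => kap *: w x + cc *: x.
  by apply/funext => x; rewrite /w scalerA mulfV ?kap_neq0// scale1r subrK.
have vv : vmeas (fun t => v (@rv R d t)) by apply/measurable_rvP.
rewrite fwd_exp_sqdev; last first.
  apply/measurable_rvP; apply: vmeasZ; apply: vmeasB => //.
  by apply: vmeasZ; exact: vmeas_rv.
rewrite sigma2_starE leeDl// mule_ge0 ?lee_fin ?sqr_ge0//.
apply: integral_ge0 => x _.
by rewrite lee_fin mulr_ge0 ?sqnorm_ge0// ltW// mix_gt0.
Qed.

End fixed.

(** * Expected exponents of the density ratio, and the final comparison *)

Lemma rev_chain_cst (mu : nat -> 'rV[R]_d -> 'rV[R]_d) (s2 : nat -> R) m acc (c : \bar R) :
  (forall k, (1 <= k <= m)%N -> 0 < s2 k) -> (0 <= c)%E ->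
  rev_chain mu s2 m acc (fun=> c) = c.
Proof.
move=> s0 c0; elim: m s0 acc => [//|m IH] s0 acc.
have sm : 0 <= s2 m.+1 by rewrite ltW// s0//= leqnn.
rewrite rev_chainS -[RHS](gauss_int_cst (mu m.+1 (acc m.+1)) sm c0).
apply: gauss_int_eq => y; apply: IH => k /andP[k1 km].
by apply: s0; rewrite k1 leqW.
Qed.

Lemma rev_exp1 (mu : nat -> 'rV[R]_d -> 'rV[R]_d) (s2 : nat -> R) :
  (forall k, (1 <= k <= N)%N -> 0 < s2 k) -> rev_exp N mu s2 (fun=> 1%E) = 1%E.
Proof.
move=> s0; rewrite /rev_exp -[RHS](@gauss_int_cst R d 0 1)//.
by apply: gauss_int_eq => y; rewrite rev_chain_cst.
Qed.

Lemma fwd_exp1 : fwd_exp N beta lam q0 (fun=> 1%E) = 1%E.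
Proof.
have [_ _ q01 _] := q0P; rewrite /fwd_exp -[RHS]q01; apply: eq_integral => t _.
rewrite -[RHS]mule1; congr (_ * _)%E.
have bN : 0 <= bbar beta N by rewrite ltW// (bbar_gt0 beta01)// N_gt0 leqnn.
rewrite -[RHS](gauss_int_cst (Num.sqrt (abar beta N) *: rv t) bN lee01).
by apply: gauss_int_eq => y; rewrite fwd_chain_cst.
Qed.

(** Minus the sum of the exponents of the Gaussian transition densities. *)
Definition sqdevs (mu : nat -> 'rV[R]_d -> 'rV[R]_d) (s2 : nat -> R) (m : nat)
    (a : nat -> 'rV[R]_d) : R :=
  \sum_(k < m) (2 * s2 k.+1)^-1 * sqnorm (a k - mu k.+1 (a k.+1)).

Lemma sqdevs_ge0 mu s2 m a : (forall k, (1 <= k <= m)%N -> 0 < s2 k) ->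
  0 <= sqdevs mu s2 m a.
Proof.
move=> s0; apply: sumr_ge0 => k _; rewrite mulr_ge0 ?sqnorm_ge0// invr_ge0 mulr_ge0//.
by rewrite ltW// s0//= ltn_ord.
Qed.

Lemma measurable_sqdevs mu s2 m dS (S : measurableType dS) (a : S -> nat -> 'rV[R]_d) :
  (forall k, (1 <= k <= m)%N -> rmeas_vec (mu k)) -> ameas a ->
  measurable_fun setT (fun s => sqdevs mu s2 m (a s)).
Proof.
move=> mmu ma; apply: measurable_sum => k; apply: measurable_funM => //.
apply: measurable_sqnorm; apply: vmeasB => //.
by apply: (pvmeas_coord k.+1 (mmu _ _)) => //=; rewrite ltn_ord.
Qed.

Lemma ln_gauss_pdf (m x : 'rV[R]_d) (b : R) : 0 < b ->
  ln (gauss_pdf m b x) = - (d%:R * ln (Num.sqrt (2 * pi * b))) - (2 * b)^-1 * sqnorm (x - m).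
Proof.
move=> b0; have s0 : 0 < Num.sqrt (2 * pi * b) by rewrite sqrtr_gt0 !mulr_gt0// pi_gt0.
rewrite /gauss_pdf lnM ?posrE ?expR_gt0 ?invr_gt0 ?exprn_gt0// expRK lnV ?posrE ?exprn_gt0//.
by rewrite lnXn// (mulr_natl (ln _) d) mulNr (mulrC (2 * b)^-1).
Qed.

(** Logarithm of the ratio of the normalising constants, the deterministic part of [ln_dratio]. *)
Definition lnorm (s2 s2' : nat -> R) (m : nat) : R :=
  \sum_(k < m) d%:R * (ln (Num.sqrt (2 * pi * s2' k.+1)) - ln (Num.sqrt (2 * pi * s2 k.+1))).

Lemma ln_dratio mu mu' (s2 s2' : nat -> R) m a :
  (forall k, (1 <= k <= m)%N -> 0 < s2 k) -> (forall k, (1 <= k <= m)%N -> 0 < s2' k) ->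
  ln (dratio mu mu' s2 s2' m a) =
  sqdevs mu' s2' m a - sqdevs mu s2 m a + lnorm s2 s2' m.
Proof.
elim: m => [|m IH] s0 s0'.
  by rewrite /dratio /sqdevs /lnorm !big_ord0 ln1 subrr addr0.
have sub (s : nat -> R) : (forall k, (1 <= k <= m.+1)%N -> 0 < s k) ->
    forall k, (1 <= k <= m)%N -> 0 < s k.
  by move=> h k /andP[k1 km]; apply: h; rewrite k1 leqW.
have sm : 0 < s2 m.+1 by apply: s0; rewrite /= leqnn.
have sm' : 0 < s2' m.+1 by apply: s0'; rewrite /= leqnn.
have p0 := gauss_pdf_gt0 (mu m.+1 (a m.+1)) (a m) sm.
have p0' := gauss_pdf_gt0 (mu' m.+1 (a m.+1)) (a m) sm'.
rewrite dratioS lnM ?posrE ?divr_gt0 ?dratio_gt0//; last 2 first.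
- exact: sub.
- exact: sub.
rewrite lnM ?lnV ?posrE ?invr_gt0// !ln_gauss_pdf// IH; [|exact: sub|exact: sub].
rewrite /sqdevs /lnorm !big_ord_recr /=.
move: (\sum_(i < m) _) (\sum_(i < m) _) (\sum_(i < m) _) => A B C.
by ring.
Qed.

Lemma pnn_EFin (f : (nat -> 'rV[R]_d) -> R) : pmeas (fun a => (f a)%:E) ->
  (forall a, 0 <= f a) -> pnn (fun a => (f a)%:E).
Proof. by move=> mf f0; split=> // a; rewrite lee_fin. Qed.

Lemma fwd_exp_sqdevsS mu (s2 : nat -> R) m : (m < N)%N ->
  (forall k, (1 <= k <= N)%N -> rmeas_vec (mu k)) ->
  (forall k, (1 <= k <= N)%N -> 0 < s2 k) ->
  (fwd_exp N beta lam q0 (fun a => (sqdevs mu s2 m.+1 a)%:E) =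
   fwd_exp N beta lam q0 (fun a => (sqdevs mu s2 m a)%:E) +
   ((2 * s2 m.+1)^-1)%:E * fwd_exp N beta lam q0 (sqdev m.+1 (mu m.+1)))%E.
Proof.
move=> mN mmu s0; have [mq q00 _ _] := q0P.
have [K kK KE] := fwd_exp_ker beta lam mq q00 N_gt0.
have sm : 0 < s2 m.+1 by exact: s0.
have c0 : 0 <= (2 * s2 m.+1)^-1 by rewrite invr_ge0 mulr_ge0// ltW.
have sub (Q : nat -> Prop) : (forall k, (1 <= k <= N)%N -> Q k) ->
    forall k, (1 <= k <= m)%N -> Q k.
  by move=> h k /andP[k1 km]; apply: h; rewrite k1 (leq_trans km)// ltnW.
have nd : pnn (sqdev m.+1 (mu m.+1)) by apply: pnn_sqdev; exact: mmu.
have ns : pnn (fun a => (sqdevs mu s2 m a)%:E).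
  apply: pnn_EFin => [dS S a ma|a]; last by apply: sqdevs_ge0; exact: sub.
  by apply/measurable_EFinP; apply: measurable_sqdevs => //; exact: sub.
rewrite !KE -(pk_scale kK)// -(pk_add kK)//.
  congr K; apply/funext => a; rewrite /sqdevs big_ord_recr /=.
  by rewrite /sqdev -EFinM -EFinD.
split=> [dS S a ma|a]; last by rewrite mule_ge0// lee_fin sqnorm_ge0.
by apply: measurable_funeM; have [h _] := nd; exact: h.
Qed.

Lemma fwd_exp_sqdevs0 mu (s2 : nat -> R) :
  fwd_exp N beta lam q0 (fun a => (sqdevs mu s2 0 a)%:E) = 0%E.
Proof.
have [mq q00 _ _] := q0P.
have [K kK KE] := fwd_exp_ker beta lam mq q00 N_gt0.
rewrite KE -[RHS](mul0e (K (fun=> 0) (fun=> 1%E))) -(@pk_scale _ _ _ kK (fun=> 0) 0 (fun=> 1%E) (lexx 0)); last first.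
  by split=> // dS S a ma; exact: measurable_cst.
by congr K; apply/funext => a; rewrite /sqdevs big_ord0 mul0e.
Qed.

Let sig := sigma2_star beta lam q0.
Let must := mu_star beta lam q0.

(** At the optimum each expected square is d sigma_n^*^2, so its weight reduces it to d / 2 whatever
    the step. *)
Lemma fwd_exp_sqdevs_star :
  fwd_exp N beta lam q0 (fun a => (sqdevs must sig N a)%:E) = (\sum_(k < N) d%:R / 2)%:E.
Proof.
have H m : (m <= N)%N -> fwd_exp N beta lam q0 (fun a => (sqdevs must sig m a)%:E) =
    (\sum_(k < m) d%:R / 2)%:E.
  elim: m => [|m IH] mN; first by rewrite fwd_exp_sqdevs0 big_ord0.
  have mN' : (1 <= m.+1 <= N)%N by [].
  rewrite fwd_exp_sqdevsS//; [|by move=> k; exact: mu_star_meas|by move=> k; exact: sigma2_star_gt0].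
  rewrite IH ?(ltnW mN)// fwd_exp_mu_star// -EFinM -EFinD big_ord_recr /=; congr (_ + _)%:E.
  have sm := sigma2_star_gt0 mN'.
  by rewrite /sig; field; rewrite gt_eqF.
exact: H.
Qed.

Lemma fwd_exp_sqdevs_ge mu (s2 : nat -> R) :
  (forall k, (1 <= k <= N)%N -> rmeas_vec (mu k) /\ 0 < s2 k) ->
  ((\sum_(k < N) d%:R * sig k.+1 / (2 * s2 k.+1))%:E <=
   fwd_exp N beta lam q0 (fun a => (sqdevs mu s2 N a)%:E))%E.
Proof.
move=> h.
have H m : (m <= N)%N -> ((\sum_(k < m) d%:R * sig k.+1 / (2 * s2 k.+1))%:E <=
    fwd_exp N beta lam q0 (fun a => (sqdevs mu s2 m a)%:E))%E.
  elim: m => [|m IH] mN; first by rewrite fwd_exp_sqdevs0 big_ord0.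
  have mN' : (1 <= m.+1 <= N)%N by [].
  have [mm sm] := h _ mN'.
  rewrite fwd_exp_sqdevsS//; [|by move=> k /h[]|by move=> k /h[]].
  rewrite big_ord_recr /= EFinD leeD ?IH ?(ltnW mN)//.
  rewrite mulrC EFinM lee_pmul2l ?lte_fin ?invr_gt0 ?mulr_gt0//.
  exact: fwd_exp_mu_ge.
exact: H.
Qed.

(* [ln x <= x - 1] at the ratio of the variances. *)
Lemma sqdevs_balance (s2 : nat -> R) : (forall k, (1 <= k <= N)%N -> 0 < s2 k) ->
  \sum_(k < N) d%:R / 2 + lnorm s2 sig N <= \sum_(k < N) d%:R * sig k.+1 / (2 * s2 k.+1).
Proof.
move=> s0; rewrite /lnorm -big_split /=; apply: ler_sum => k _.
have kN : (1 <= k.+1 <= N)%N by rewrite /= ltn_ord.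
have sk := s0 _ kN; have gk : 0 < sig k.+1 by exact: sigma2_star_gt0.
have c0 : 0 < 2 * pi :> R by rewrite mulr_gt0// pi_gt0.
have lnsq (x : R) : 0 < x -> ln (Num.sqrt (2 * pi * x)) = (ln (2 * pi) + ln x) / 2.
  move=> x0; have cx : 0 < 2 * pi * x by rewrite mulr_gt0.
  rewrite -lnM ?posrE// -[in RHS](sqr_sqrtr (ltW cx)) lnXn ?sqrtr_gt0//.
  by rewrite -[in RHS](mulr_natr (ln _)) mulfK ?pnatr_eq0.
rewrite !lnsq//.
have := @ln_le_subr1 R (sig k.+1 / s2 k.+1) (divr_gt0 gk sk).
rewrite lnM ?posrE ?invr_gt0// lnV ?posrE// => l.
have -> : d%:R * sig k.+1 / (2 * s2 k.+1) = d%:R / 2 * (sig k.+1 / s2 k.+1).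
  by field; rewrite gt_eqF.
have -> : d%:R / 2 + d%:R * ((ln (2 * pi) + ln (sig k.+1)) / 2 - (ln (2 * pi) + ln (s2 k.+1)) / 2) =
  d%:R / 2 * (1 + (ln (sig k.+1) - ln (s2 k.+1))) by field.
by rewrite ler_wpM2l// divr_ge0.
Qed.

(** [KL_le_of_ratio] integrates against genuine finite measures, whereas [rev_measure] is defined
    only as a set function. *)
Lemma rev_measureE mu (s2 : nat -> R) : (forall k, (1 <= k <= N)%N -> rmeas_vec (mu k)) ->
  (forall k, (1 <= k <= N)%N -> 0 < s2 k) ->
  exists P : {measure set (N.+1.-tuple (d.-tuple R)) -> \bar R},
    [/\ (P : set _ -> \bar R) = rev_measure N mu s2, (P setT < +oo)%E &
    forall f, nnm f -> (\int[P]_x f x = rev_exp N mu s2 (fun a => f (joint_of N a)))%E].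
Proof.
move=> mmu s0; have [K kK KE] := rev_exp_ker s2 mmu.
have [P [PE PI]] := daniell_measure (pker_daniell N (fun=> 0) kK).
have PE' : (P : set _ -> \bar R) = rev_measure N mu s2.
  by rewrite PE; apply/funext => A; rewrite -KE.
exists P; split=> //; last by move=> f nf; rewrite PI// KE.
rewrite PE' (_ : rev_measure N mu s2 setT = 1%E) ?ltry//.
rewrite -(rev_exp1 mu s0) /rev_measure /rev_exp; apply: gauss_int_eq => y.
by congr rev_chain; apply/funext => a; rewrite indicT.
Qed.

Lemma KL_mu_star_le mu (s2 : nat -> R) :
  (forall k, (1 <= k <= N)%N -> rmeas_vec (mu k) /\ 0 < s2 k) ->
  (KL (fwd_measure N beta lam q0) (rev_measure N must sig) <=
   KL (fwd_measure N beta lam q0) (rev_measure N mu s2))%E.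
Proof.
move=> h.
have mmu k : (1 <= k <= N)%N -> rmeas_vec (mu k) by move=> /h[].
have s0 k : (1 <= k <= N)%N -> 0 < s2 k by move=> /h[].
have mmust k : (1 <= k <= N)%N -> rmeas_vec (must k) by exact: mu_star_meas.
have sig0 k : (1 <= k <= N)%N -> 0 < sig k by exact: sigma2_star_gt0.
have [P [<- PT PI]] := rev_measureE mmust sig0.
have [P' [<- PT' PI']] := rev_measureE mmu s0.
have [mq q00 _ _] := q0P.
have [K kK KE] := fwd_exp_ker beta lam mq q00 N_gt0.
pose EQ (f : N.+1.-tuple (d.-tuple R) -> \bar R) :=
  fwd_exp N beta lam q0 (fun a => f (joint_of N a)).
have DQ : daniell EQ.
  rewrite (_ : EQ = fun f => K (fun=> 0) (fun b => f (joint_of N b))).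
    exact: pker_daniell.
  by apply/funext => f; rewrite /EQ KE.
have -> : fwd_measure N beta lam q0 = (fun A => EQ (fun x => (\1_A x : R)%:E)) by [].
pose r (X : N.+1.-tuple (d.-tuple R)) := dratio mu must s2 sig N (path_of X).
pose A (X : N.+1.-tuple (d.-tuple R)) := sqdevs mu s2 N (path_of X).
pose B (X : N.+1.-tuple (d.-tuple R)) := sqdevs must sig N (path_of X).
have sqd (nu : nat -> 'rV[R]_d -> 'rV[R]_d) (t2 : nat -> R) (a : nat -> 'rV[R]_d) :
    sqdevs nu t2 N (path_of (joint_of N a)) = sqdevs nu t2 N a.
  by apply: eq_bigr => k _; rewrite !path_of_joint// ltnW.
have dr (a : nat -> 'rV[R]_d) :
    dratio mu must s2 sig N (path_of (joint_of N a)) = dratio mu must s2 sig N a.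
  by apply: eq_bigr => k _; rewrite !path_of_joint// ltnW.
have EQsq (nu : nat -> 'rV[R]_d -> 'rV[R]_d) (t2 : nat -> R) :
    EQ (EFin \o (fun X => sqdevs nu t2 N (path_of X))) =
    fwd_exp N beta lam q0 (fun a => (sqdevs nu t2 N a)%:E).
  rewrite /EQ; apply: (congr1 (fwd_exp N beta lam q0)).
  by apply/funext => a; rewrite /= sqd.
have mr : measurable_fun setT r.
  by apply: measurable_dratio => //; exact: ameas_path_of.
have r0 X : 0 < r X by exact: dratio_gt0.
apply: (@KL_le_of_ratio _ _ _ EQ P P' r A B (lnorm s2 sig N) (\sum_(k < N) d%:R / 2)
  (\sum_(k < N) d%:R * sig k.+1 / (2 * s2 k.+1))) => //.
- exact: fwd_exp1.
- move=> g [mg g0]; rewrite PI' ?PI//; last first.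
    split=> [|x]; last by rewrite mule_ge0// lee_fin ltW.
    by apply: emeasurable_funM => //; exact/measurable_EFinP.
  rewrite /rev_exp; apply: gauss_int_eq => y.
  rewrite (rev_chain_dratio _ mmu mmust s0 sig0); last exact: pnn_joint.
  have rE (a : nat -> 'rV[R]_d) : r (joint_of N a) = dratio mu must s2 sig N a by exact: dr.
  apply: rev_chain_local => a _.
  by rewrite rE.
- by apply: measurable_sqdevs => //; exact: ameas_path_of.
- by apply: measurable_sqdevs => //; exact: ameas_path_of.
- by move=> X; exact: sqdevs_ge0.
- by move=> X; exact: sqdevs_ge0.
- by move=> X; exact: ln_dratio.
- by rewrite EQsq fwd_exp_sqdevs_star.
- by rewrite EQsq; exact: fwd_exp_sqdevs_ge.
- exact: sqdevs_balance.
Qed.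

End Level.

Unset Implicit Arguments.

Theorem theorem1 (R : realType) (d N : nat) (beta lam : nat -> R)
  (q0 : 'rV[R]_d -> R) :
  (0 < d)%N -> (0 < N)%N ->
  (forall n, (1 <= n <= N)%N -> 0 < beta n < 1) ->
  (forall n, (1 <= n <= N)%N -> 0 <= lam n /\ lam n ^+ 2 <= bbar beta n.-1) ->
  is_density_2mom q0 ->
  (forall n, (1 <= n <= N)%N ->
     rmeas_vec (mu_star beta lam q0 n) /\ 0 < sigma2_star beta lam q0 n) /\
  (forall (mu : nat -> 'rV[R]_d -> 'rV[R]_d) (s2 : nat -> R),
     (forall n, (1 <= n <= N)%N -> rmeas_vec (mu n) /\ 0 < s2 n) ->
     (KL (fwd_measure N beta lam q0)
         (rev_measure N (mu_star beta lam q0) (sigma2_star beta lam q0))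
      <= KL (fwd_measure N beta lam q0) (rev_measure N mu s2))%E).
Proof.
move=> d0 N0 beta01 lamP q0P; split=> [n nN|mu s2 h].
  by split; [apply: (@mu_star_meas _ _ N)|apply: (@sigma2_star_gt0 _ _ N)].
exact: KL_mu_star_le.
Qed.
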